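(* Let $d\ge2$ be an integer. Let $\{G_n\}$ be a family of $d$-regular graphs such that $\lim_{n\to\infty}|G_n|=\infty$ and, for all $n$, $$\mathfrak m(G_n)\le\frac{\log^2|G_n|}{(\log\log|G_n|)^5}.$$ For all $n$ let $D(n)$ be the density at infinity of the $G_n$-Cylinder-DLA process. Then $$\lim_{n\to\infty}D(n)=0.$$
   Context: Graphs $G$ are finite, simple and connected; $|G|$ is the number of vertices. $\mathbb N=\{0,1,2,\dots\}$; $\log$ is the natural logarithm. Mixing time: for a $d$-regular graph $G$ let $(g'_t)_{t\ge0}$ be the lazy random walk on $G$ which at each step chooses uniformly among the current vertex and its $d$ neighbours. Then $\mathfrak m(G)=\min\{t>0: \forall u,v\in G,\ \forall s\ge t,\ \Pr[g'_s=u\mid g'_0=v]\ge \frac1{2|G|}\}$. Cylinder: $G\times\mathbb N$ has vertex set $V(G)\times\mathbb N$, with $(u,m)\sim(v,k)$ iff either $m=k$ and $u\sim v$, or $|m-k|=1$ and $u=v$. The $i$-th layer is $G_i=V(G)\times\{i\}$. For a set $A$ of vertices of $G\times\mathbb N$, $\partial A$ is the set of vertices not in $A$ that are adjacent to some vertex of $A$. $G$-Cylinder-DLA process: a random increasing sequence $(A_t)_{t\ge 0}$ of vertex sets with $A_0=G_0$. Given $A_0,\dots,A_t$, put $M(t)=\min\{i\in\mathbb N: G_i\cap A_t=\emptyset\}$ and let $(g_{t+1}(r),\zeta_{t+1}(r))_{r\ge0}$ be a simple random walk on $G\times\mathbb N$ (each step goes to a uniformly random neighbour) with $g_{t+1}(0)$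 uniform on $V(G)$ and $\zeta_{t+1}(0)=M(t)$. Let $\kappa(t+1)=\min\{r\ge0:(g_{t+1}(r),\zeta_{t+1}(r))\in\partial A_t\}$ (a.s. finite) and $A_{t+1}=A_t\cup\{(g_{t+1}(\kappa(t+1)),\zeta_{t+1}(\kappa(t+1)))\}$. Density at infinity of the $G$-Cylinder-DLA process: with $A_\infty=\bigcup_{t\ge0}A_t$, it is $\lim_{m\to\infty}\frac1{m|G|}\sum_{i=1}^m|A_\infty\cap G_i|$. By standard ergodic arguments this limit exists and is almost surely constant, so it is regarded as a number. *)

(* Defs.v *)
From HB Require Import structures.
From mathcomp Require Import all_boot all_order all_algebra.
From mathcomp Require Import all_classical all_reals all_analysis.
Import Order.TTheory GRing.Theory Num.Theory.
Import numFieldNormedType.Exports.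

Set Implicit Arguments.
Unset Strict Implicit.
Unset Printing Implicit Defensive.

Local Open Scope classical_set_scope.
Local Open Scope ring_scope.

(* [is_min S i] : i = min S.  The minima of the text (mixing time, first empty
   layer, hitting time) are all expressed by this functional relation, so that
   no default value is needed when S is empty. *)
Definition is_min (S : set nat) (i : nat) : Prop :=
  S i /\ forall j, S j -> (i <= j)%N.

Record sgraph := SGraph {
  vertex :> finType;
  adj : rel vertex;
  adj_sym : symmetric adj;
  adj_irr : irreflexive adj }.

Arguments adj {s}.

Definition degree (G : sgraph) (u : G) : nat := #|[pred v | adj u v]|.

Definition regular (d : nat) (G : sgraph) : Prop :=
  forall u : G, degree u = d.

Definition connected_graph (G : sgraph) : Prop :=
  (0 < #|G|)%N /\ forall u v : G, connect adj u v.

Section MixingTime.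
Variables (R : realType) (G : sgraph).

Definition lazy_step (u v : G) : R :=
  ((u == v) || adj u v)%:R / (degree u).+1%:R.

(* Pr[g'_s = u | g'_0 = v] *)
Fixpoint lazy_prob (s : nat) (v u : G) : R :=
  if s is s'.+1 then \sum_(w : G) lazy_step v w * lazy_prob s' w u
  else (v == u)%:R.

Definition is_mixing_time (m : nat) : Prop :=
  is_min [set t | (0 < t)%N /\
            forall (u v : G) (s : nat), (t <= s)%N ->
              (2 * #|G|%:R)^-1 <= lazy_prob s v u] m.

End MixingTime.

Section Cylinder.
Variable G : sgraph.

Definition cyl : Type := (G * nat)%type.

Definition cyl_adj (x y : cyl) : bool :=
  ((x.2 == y.2) && adj x.1 y.1) ||
  (((x.2 == y.2.+1) || (y.2 == x.2.+1)) && (x.1 == y.1)).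

(* Number of neighbours of x; they all lie in layers 0, ..., x.2.+1. *)
Definition cyl_degree (x : cyl) : nat :=
  \sum_(k < x.2.+2) #|[pred v : G | cyl_adj x (v, val k)]|.

Definition layer (i : nat) : set cyl := [set x | x.2 = i].

Definition boundary (A : set cyl) : set cyl :=
  [set y | ~ A y /\ exists2 x, A x & cyl_adj x y].

Definition is_first_empty_layer (A : set cyl) (i : nat) : Prop :=
  is_min [set j | layer j `&` A = set0] i.

Definition is_hitting_time (x : nat -> cyl) (B : set cyl) (r : nat) : Prop :=
  is_min [set q | B (x q)] r.

End Cylinder.

Section SimpleRandomWalk.
Variables (R : realType) (G : sgraph).

Definition cyl_step (x y : cyl G) : R :=
  (cyl_adj x y)%:R / (cyl_degree x)%:R.

(* Probability that the simple random walk on the cylinder started uniformly on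
   the first empty layer of A visits x 0, ..., x r in its first r steps. *)
Definition walk_prob (A : set (cyl G)) (x : nat -> cyl G) (r : nat) : R :=
  `[< is_first_empty_layer A (x 0%N).2 >]%:R / #|G|%:R *
  \prod_(i < r) cyl_step (x i) (x i.+1).

End SimpleRandomWalk.

Section CylinderDLA.
Variables (R : realType) (G : sgraph).
Variables (disp : measure_display) (Omega : measurableType disp).
Variable P : probability Omega R.

(* [W t r w] is the position (g_t(r), zeta_t(r)) of the t-th particle after r
   steps, for t >= 1; W 0 plays no role. *)
Variable W : nat -> nat -> Omega -> cyl G.

(* On the null event that kappa(t+1) is infinite, no vertex is added. *)
Fixpoint aggregate (t : nat) (w : Omega) : set (cyl G) :=
  if t is t'.+1 then
    let A := aggregate t' w in
    A `|` [set W t'.+1 r w | r in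
             [set r | is_hitting_time (fun q => W t'.+1 q w) (boundary A) r]]
  else @layer G 0%N.

(* The sets A_t take only countably many values (they are finite), so that the
   conditional law of the (t+1)-st walk given A_0, ..., A_t is described by
   elementary conditioning on the events A_0 = a_0, ..., A_t = a_t. *)
Definition is_cylinder_dla : Prop :=
  (forall t r (x : cyl G), measurable [set w | W t.+1 r w = x]) /\
  (forall t (a : nat -> set (cyl G)) r (x : nat -> cyl G),
     let past := [set w | forall s, (s <= t)%N -> aggregate s w = a s] in
     P (past `&` [set w | forall q, (q <= r)%N -> W t.+1 q w = x q]) =
     (P past * (walk_prob R (a t) x r)%:E)%E).

Definition final_aggregate (w : Omega) : set (cyl G) :=
  \bigcup_t aggregate t w.

Definition density_upto (w : Omega) (m : nat) : R :=
  (m%:R * #|G|%:R)^-1 *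
  \sum_(1 <= i < m.+1) #|[pred v : G | (v, i) \in final_aggregate w]|%:R.

Definition is_density_at_infinity (D : R) : Prop :=
  {ae P, forall w, density_upto w m @[m --> \oo] --> D}.

End CylinderDLA.

(* Main.v *)
Require Import Defs.
From HB Require Import structures.
From mathcomp Require Import all_boot all_order all_algebra.
From mathcomp Require Import all_classical all_reals all_analysis.
From mathcomp Require Import measurable_realfun ring lra zify.
Import Order.TTheory GRing.Theory Num.Theory.
Import numFieldNormedType.Exports.

(** Write [n] for the size of the base graph. For every integer [omega], the
    density at infinity is at most [2 / omega] as soon as [n] is large.

    Only the height at which a particle sticks matters. The probability
    [stick i x] that a walk from [x] sticks above layer [i] is superharmonic on
    the layers above [i], and the walk starts uniformly on the first empty layer
    [M], so that its sum over that layer decides. The sums over the layers form a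
    concave nonnegative sequence, hence a nondecreasing one: a layer with [l]
    particles makes the next particle stick above it with probability at least
    [l / n] ([load_le_sum_stick]).

    Two mechanisms make the cluster grow. Suppose first that the [h] layers below
    [M] are light. Then the next particle opens layer [M] with probability at
    least [omega / n] ([light_sum_stick]): the walk visits layer [M] of the order
    of [h] times before it gets stuck or leaves the window, it is nearly uniform
    as soon as it has spent the mixing time above [M], and by reversal the total
    chance of hitting a tip is the expected number of visits to layer [M] of a
    walk started at the tip, which stays above [M] for the mixing time with
    probability of the order of its inverse square root. Suppose next that one of
    these [h] layers carries at least [B ^ h] particles. Then the loads must drop
    by a factor [B] somewhere below [M] ([exists_load_drop]): there are [k] and a
    layer of load at least [B ^ k] above which all loads are below [B ^ k.-1].
    Particles stick above that layer with probability at least [B ^ k / n].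

    Both mechanisms are measured by one function of the cluster, the sum over the
    layers of [h] if the layer is occupied and of the truncated loads
    [minn l (B ^ k) / B ^ k] for [k < h]. With [B = omega * h] its mean increment
    is at least [h * omega / n] in both cases, while it is at most [2 * h] times
    the number of layers. Hence at most [2 * (m + 1) * n / omega] particles are
    expected before the cluster outgrows layer [m]. The two requirements on [h],
    to be large compared with the square root of the mixing time and to keep
    [B ^ h] small compared with [n], are compatible because the mixing
    time is slightly smaller than the square of [ln n].

    Particles that come later may still fall into the layers up to [m], but they
    have to avoid every occupied layer on the way, which has exponentially small
    probability in the depth ([stick_deep]). A second function of the cluster
    pays for them; it is bounded by a constant that depends on the graph and not
    on [m], so that they do not contribute to the density. The comparison of the
    mean number of particles with these two functions is [mean_low_count_le]. *)

Set Implicit Arguments.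
Unset Strict Implicit.
Unset Printing Implicit Defensive.

Local Open Scope classical_set_scope.
Local Open Scope ring_scope.

(** * Concave sequences *)

Section ConcaveSequences.
Variable R : realType.
Implicit Type a : nat -> R.

(** One negative increment would force a linear decrease below zero. *)
Lemma concave_ge0_nondecreasing a k :
  (forall j, 0 <= a j) ->
  (forall j, (k <= j)%N -> a j + a j.+2 <= 2 * a j.+1) ->
  forall i j, (k <= i <= j)%N -> a i <= a j.
Proof.
move=> a0 ac.
have incr j : (k <= j)%N -> a j <= a j.+1.
  move=> kj; rewrite leNgt; apply/negP => lt_a.
  have decr i : a (j + i).+1 <= a (j + i)%N + (a j.+1 - a j).
    elim: i => [|i IH]; first by rewrite addn0; lra.
    rewrite addnS; have := ac (j + i)%N (leq_trans kj (leq_addr _ _)); lra.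
  have lin i : a (j + i)%N <= a j - (a j - a j.+1) *+ i.
    elim: i => [|i IH]; first by rewrite addn0 mulr0n subr0.
    by rewrite addnS mulrS; have := decr i; lra.
  have e0 : 0 < a j - a j.+1 by lra.
  have := archi_boundP (divr_ge0 (a0 j) (ltW e0)).
  set N := Num.bound _; rewrite ltr_pdivrMr// mulrC mulr_natr => aN.
  by have := lin N; have := a0 (j + N)%N; lra.
move=> i j /andP[ki]; elim: j => [|j IH]; first by rewrite leqn0 => /eqP ->.
rewrite leq_eqVlt => /predU1P[->//|]; rewrite ltnS => ij.
exact: le_trans (IH ij) (incr _ (leq_trans ki ij)).
Qed.

(** From its first negative term on, the sequence would decrease up to the right
    end. *)
Lemma concave_boundary_ge0 a N :
  0 <= a 0%N -> 0 <= a N ->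
  (forall j, (j.+1 < N)%N -> a j.+1 < 0 -> a j + a j.+2 <= 2 * a j.+1) ->
  forall j, (j <= N)%N -> 0 <= a j.
Proof.
move=> a0 aN ac j jN; rewrite leNgt; apply/negP => aj.
have ex : exists i, a i < 0 by exists j.
have [[|i] ai mini] := ex_minnP ex; first by lra.
have ai0 : 0 <= a i.
  by rewrite leNgt; apply/negP => /mini; rewrite ltnn.
have iN : (i.+1 <= N)%N by exact: leq_trans (mini _ aj) jN.
have H k : (i.+1 + k <= N)%N -> a (i.+1 + k)%N < 0 /\ a (i.+1 + k)%N <= a (i + k)%N.
  elim: k => [|k IH]; first by rewrite !addn0; split=> //; lra.
  rewrite !addnS !addSn => kN; have [h1 h2] := IH (ltnW kN).
  by move: h1 h2; rewrite addSn => h1 h2; have := ac (i + k)%N kN h1; split; lra.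
have [] := H (N - i.+1)%N; first by rewrite subnKC.
by rewrite subnKC// => ? _; lra.
Qed.

End ConcaveSequences.

(** * One step of the walk on the cylinder *)

Section Cylinder.
Variables (R : realType) (G : sgraph) (d : nat).
Hypothesis Greg : regular d G.
Implicit Types (f g : cyl G -> R) (x y : cyl G).

(** The mean of [f] over the [d + 2] neighbours of a vertex outside layer 0. *)
Definition nbr_mean f x : R :=
  (\sum_(u | adj x.1 u) f (u, x.2) + f (x.1, x.2.+1) + f (x.1, x.2.-1))
    / (d + 2)%:R.

Let D0 : 0 < (d + 2)%:R :> R. Proof. by rewrite ltr0n addn2. Qed.

Lemma sum_adj_const v (c : R) : \sum_(u : G | adj v u) c = d%:R * c.
Proof. by rewrite sumr_const -(Greg v) mulr_natl. Qed.

Lemma nbr_meanM f x :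
  (d + 2)%:R * nbr_mean f x =
  \sum_(u | adj x.1 u) f (u, x.2) + f (x.1, x.2.+1) + f (x.1, x.2.-1).
Proof. by rewrite /nbr_mean mulrC divfK// gt_eqF. Qed.

Lemma nbr_mean_cst c x : nbr_mean (fun=> c) x = c.
Proof.
apply: (mulfI (lt0r_neq0 D0)).
by rewrite nbr_meanM sum_adj_const natrD; ring.
Qed.

Lemma le_nbr_mean f g x :
  (forall y, f y <= g y) -> nbr_mean f x <= nbr_mean g x.
Proof.
move=> fg; rewrite ler_pM2r ?invr_gt0//.
by rewrite !lerD// ler_sum.
Qed.

Lemma nbr_mean_ge0 f x : (forall y, 0 <= f y) -> 0 <= nbr_mean f x.
Proof.
by move=> f0; rewrite -(nbr_mean_cst 0 x); exact: le_nbr_mean.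
Qed.

Lemma cyl_adj_layer (v u : G) j k :
  cyl_adj (v, j) (u, k) =
  ((j == k) && adj v u) || (((j == k.+1) || (k == j.+1)) && (v == u)).
Proof. by []. Qed.

(** The values lie in an arbitrary monoid, so that this covers both the degree
    and the step of the walk. *)
Lemma sum_cyl_adj (V : nmodType) (F : cyl G -> V) v j :
  \sum_(k < j.+3) \sum_(u : G | cyl_adj (v, j.+1) (u, val k)) F (u, val k) =
  \sum_(u | adj v u) F (u, j.+1) + F (v, j.+2) + F (v, j).
Proof.
rewrite (big_ord_recr j.+2) (big_ord_recr j.+1) (big_ord_recr j) /=.
rewrite big1 ?add0r; last first.
  move=> k _; apply: big_pred0 => u; rewrite cyl_adj_layer.
  by have := ltn_ord k; case: eqP => [?|_]; lia.
rewrite -addrA addrC; congr (_ + _ + _).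
- apply: eq_bigl => u; rewrite cyl_adj_layer eqxx /=.
  by rewrite eqn_leq ltnn ?andbF ?orbF.
- rewrite (big_pred1 v)// => u; rewrite cyl_adj_layer eqxx orbT/=.
  by rewrite eqn_leq ltnn ?andbF ?orbF.
- rewrite (big_pred1 v)// => u; rewrite cyl_adj_layer eqxx /=.
  by rewrite eqn_leq ltnn ?andbF ?orbF.
Qed.

Lemma cyl_degreeS (v : G) j : cyl_degree ((v, j.+1) : cyl G) = (d + 2)%N.
Proof.
rewrite /cyl_degree; under eq_bigr do rewrite -sum1_card.
rewrite (sum_cyl_adj (fun=> 1%N)) sum1_card [#|_|]Greg.
exact: (esym (addnA d 1 1)).
Qed.

(** Outside layer 0 the cylinder has constant degree, so one step of the walk
    averages over the neighbours. *)
Lemma sum_cyl_step f x : (0 < x.2)%N ->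
  \sum_(k < x.2.+2) \sum_(u : G) cyl_step R x (u, val k) * f (u, val k) =
  nbr_mean f x.
Proof.
case: x => v [//|j] _ /=.
apply: (mulfI (lt0r_neq0 D0)); rewrite nbr_meanM/=.
rewrite -(sum_cyl_adj f) mulr_sumr; apply: eq_bigr => k _.
rewrite mulr_sumr [RHS]big_mkcond; apply: eq_bigr => u _.
rewrite /cyl_step cyl_degreeS; case: ifP => _; last by rewrite !(mul0r, mulr0).
by rewrite mul1r mulrA mulfV ?mul1r// gt_eqF.
Qed.

End Cylinder.

(** * Killed walks *)

Section Green.
Variables (R : realType) (G : sgraph) (d : nat).
Variables (D : cyl G -> bool) (g : cyl G -> R).

(** The expected value of [g] summed along the first [N] positions of the walk
    that is killed on leaving [D]. *)
Fixpoint green_upto N x : R :=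
  if N is N'.+1 then g x + (if D x then nbr_mean d (green_upto N') x else 0)
  else 0.

Definition green x : R := limn (green_upto ^~ x).

(** A supersolution [b] bounds the partial sums, whose limit is then a solution. *)
Section Supersolution.
Variable b : cyl G -> R.
Hypothesis Greg : regular d G.
Hypothesis g0 : forall x, 0 <= g x.
Hypothesis b0 : forall x, 0 <= b x.
Hypothesis supb : forall x, g x + (if D x then nbr_mean d b x else 0) <= b x.

Lemma green_upto_ge0 N x : 0 <= green_upto N x.
Proof.
elim: N x => //= N IH x; rewrite addr_ge0//.
by case: ifP => // _; exact: nbr_mean_ge0.
Qed.

Lemma green_upto_le_super N x : green_upto N x <= b x.
Proof.
elim: N x => //= N IH x; apply: le_trans (supb x); rewrite lerD2l.
by case: ifP => // _; exact: le_nbr_mean.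
Qed.

Lemma green_upto_leS N x : green_upto N x <= green_upto N.+1 x.
Proof.
elim: N x => [|N IH] x; first exact: green_upto_ge0.
by rewrite /= lerD2l; case: ifP => // _; exact: le_nbr_mean.
Qed.

Lemma green_upto_nd x : nondecreasing_seq (green_upto ^~ x).
Proof. by apply/nondecreasing_seqP => N; exact: green_upto_leS. Qed.

Lemma cvg_green_upto x : green_upto ^~ x @ \oo --> green x.
Proof.
apply: nondecreasing_is_cvgn; first exact: green_upto_nd.
by exists (b x) => _ [N _ <-]; exact: green_upto_le_super.
Qed.

Lemma green_upto_le N x : green_upto N x <= green x.
Proof.
apply: (nondecreasing_cvgn_le (@green_upto_nd x)).
apply: cvgP; exact: cvg_green_upto.
Qed.

Lemma green_ge0 x : 0 <= green x.
Proof. exact: green_upto_le 0%N x. Qed.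

Lemma green_le x : green x <= b x.
Proof.
have cu : cvgn (green_upto ^~ x) by apply: cvgP; exact: cvg_green_upto.
apply: (limr_le cu).
by near=> N; exact: green_upto_le_super.
Unshelve. all: by end_near. Qed.

Lemma greenE x : green x = g x + (if D x then nbr_mean d green x else 0).
Proof.
have := @cvg_green_upto x; rewrite -cvg_shiftS /= => gx.
apply: (cvg_unique _ gx) => //.
apply: cvgD; first exact: cvg_cst.
case: ifP => _; last exact: cvg_cst.
apply: cvgMl; apply: cvgD; last exact: cvg_green_upto.
apply: cvgD; last exact: cvg_green_upto.
apply: cvg_big => [|u _]; [exact: add_continuous|exact: cvg_green_upto].
Qed.

End Supersolution.
End Green.

(** * Sticking probabilities *)

Lemma sum_adj_sum (R : realType) (G : sgraph) d (Greg : regular d G)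
    (f : G -> R) :
  \sum_v \sum_(u | adj v u) f u = d%:R * \sum_v f v.
Proof.
rewrite (exchange_big_dep xpredT)//= mulr_sumr; apply: eq_bigr => u _.
under eq_bigl do rewrite adj_sym.
by rewrite (sum_adj_const Greg).
Qed.

Lemma sum_nbr_mean (R : realType) (G : sgraph) d (Greg : regular d G)
    (f : cyl G -> R) j :
  (d + 2)%:R * (\sum_v nbr_mean d f (v, j)) =
  d%:R * (\sum_v f (v, j)) + \sum_v f (v, j.+1) + \sum_v f (v, j.-1).
Proof.
rewrite mulr_sumr; under eq_bigr do rewrite nbr_meanM/=.
by rewrite !big_split/= (sum_adj_sum Greg (fun u => f (u, j))).
Qed.

Section Cluster.
Variables (R : realType) (G : sgraph).
Implicit Types (A : set (cyl G)) (x y : cyl G).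

Definition load A j : nat := #|[pred v : G | (v, j) \in A]|.

Definition is_cluster A M : Prop :=
  (forall v : G, A (v, 0%N)) /\ forall j, (0 < load A j)%N = (j < M)%N.

Definition hull A : set (cyl G) := A `|` boundary A.

(** The probability that the walk sticks above layer [i]; the points of the
    cluster itself count as sticking, which makes this function superharmonic
    on the layers above [i]. *)
Definition stick d A i : cyl G -> R :=
  green d (fun x => x \notin hull A)
    (fun x => ((x \in hull A) && (i < x.2)%N)%:R).

Lemma cyl_adj_sym x y : cyl_adj x y = cyl_adj y x.
Proof.
rewrite /cyl_adj adj_sym (eq_sym x.2 y.2) (eq_sym x.1 y.1).
by congr (_ || _ && _); rewrite orbC.
Qed.

Lemma adj_hull A x y : A x -> cyl_adj x y -> hull A y.
Proof.
by move=> Ax xy; have [Ay|nAy] := pselect (A y); [left|right; split => //; exists x].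
Qed.

Lemma up_hull A (v : G) j : A (v, j) -> hull A (v, j.+1).
Proof. by move/adj_hull; apply; rewrite cyl_adj_layer !eqxx !orbT. Qed.

Lemma hull_adj A x : hull A x -> A x \/ exists2 y, A y & cyl_adj x y.
Proof.
case=> [|[_ [y Ay yx]]]; [by left|right].
by exists y => //; rewrite cyl_adj_sym.
Qed.

Lemma load_gt0P A j : reflect (exists v, A (v, j)) (0 < load A j)%N.
Proof.
apply: (iffP card_gt0P) => -[v vA]; exists v; first by move: vA; rewrite !inE.
by rewrite !inE.
Qed.

Section Fixed.
Variables (d M : nat) (A : set (cyl G)).
Hypothesis Greg : regular d G.
Hypothesis AM : is_cluster A M.

Lemma cluster_lt (v : G) j : A (v, j) -> (j < M)%N.
Proof. by move=> Av; rewrite -AM.2; apply/load_gt0P; exists v. Qed.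

Lemma hull_le x : hull A x -> (x.2 <= M)%N.
Proof.
case: x => v j /hull_adj[/cluster_lt/ltnW//|[[u k] /cluster_lt kM]].
rewrite cyl_adj_layer /= => /orP[/andP[/eqP kj _]|/andP[/orP[]/eqP kj _]].
- by rewrite kj ltnW.
- by rewrite kj.
- by rewrite kj in kM; exact: ltnW (ltnW kM).
Qed.

Lemma notin_hull_gt0 x : x \notin hull A -> (0 < x.2)%N.
Proof.
case: x => v [|//]; rewrite notin_setE => -[]; left; exact: AM.1.
Qed.

Lemma stick_supersolution i x :
  ((x \in hull A) && (i < x.2)%N)%:R +
    (if x \notin hull A then nbr_mean d (fun=> 1) x else 0) <= 1 :> R.
Proof.
case: ifP => [/negPf->|/negbFE ->]/=.
  by rewrite add0r nbr_mean_cst.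
by rewrite addr0 lern1 leq_b1.
Qed.

Let sup i := @stick_supersolution i.

Lemma stick_ge0 i x : 0 <= stick d A i x.
Proof. by apply: (green_ge0 Greg (b := fun=> 1)) => [y|y|y]; by [|exact: sup]. Qed.

Lemma stick_le1 i x : stick d A i x <= 1.
Proof. by apply: (green_le Greg (b := fun=> 1)) => [y|y|y]; by [|exact: sup]. Qed.

Lemma stick_in i x : x \in hull A -> stick d A i x = (i < x.2)%:R.
Proof.
move=> xA; rewrite /stick (greenE Greg (b := fun=> 1)); [|by []|by []|exact: sup].
by rewrite xA addr0.
Qed.

Lemma stick_out i x :
  x \notin hull A -> stick d A i x = nbr_mean d (stick d A i) x.
Proof.
move=> xA; rewrite {1}/stick (greenE Greg (b := fun=> 1)); [|by []|by []|exact: sup].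
by rewrite xA (negPf xA) add0r.
Qed.

Lemma stick_superharmonic i x :
  (i < x.2)%N -> nbr_mean d (stick d A i) x <= stick d A i x.
Proof.
move=> ix; have [xA|xA] := boolP (x \in hull A); last by rewrite -stick_out.
rewrite stick_in// ix -[leRHS](nbr_mean_cst Greg 1 x).
by apply: le_nbr_mean => // y; exact: stick_le1.
Qed.

(** The sums over the layers form a concave nonnegative, hence nondecreasing,
    sequence above [i]: the walk comes down to layer [i.+1] at a uniform
    place unless it sticks before. *)
Lemma load_le_sum_stick i : (i < M)%N ->
  (load A i)%:R <= \sum_v stick d A i (v, M).
Proof.
move=> iM; apply: (@le_trans _ _ (\sum_v stick d A i (v, i.+1))).
  rewrite /load -sum1_card natr_sum [leLHS]big_mkcond/=.
  apply: ler_sum => v _; case: ifP => [|_]; last exact: stick_ge0.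
  rewrite !inE => Av; rewrite stick_in ?ltnSn// inE; exact: up_hull.
pose a j := \sum_v stick d A i (v, j).
have := @concave_ge0_nondecreasing R a i.+1; apply; last by rewrite iM leqnn.
- by move=> j; apply: sumr_ge0 => v _; exact: stick_ge0.
- move=> j ij; have : (d + 2)%:R * (\sum_v nbr_mean d (stick d A i) (v, j.+1)) <=
      (d + 2)%:R * a j.+1.
    rewrite ler_pM2l ?ltr0n ?addn2//; apply: ler_sum => v _.
    by apply: stick_superharmonic => /=; lia.
  by rewrite (sum_nbr_mean Greg) natrD -/(a _) -/(a _) -/(a _) /=; lra.
Qed.

(** The walk is recurrent in the vertical direction: a lower bound on one layer
    persists on all the layers above, as the minima over the layers form a
    concave nonnegative sequence. *)
Lemma stick_above i k c : (i <= k)%N ->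
  (forall v, c <= stick d A i (v, k)) ->
  forall v j, (k <= j)%N -> c <= stick d A i (v, j).
Proof.
move=> ik ck v j kj.
pose w j := [arg min_(u < v) stick d A i (u, j)]%O.
pose a j := stick d A i (w j, j).
have aP u l : a l <= stick d A i (u, l).
  by rewrite /a /w; case: arg_minP => // u0 _; apply.
apply: le_trans (ck (w k)) _; apply: le_trans _ (aP v j).
apply: (@concave_ge0_nondecreasing R a k) => //; last by rewrite leqnn.
- by move=> l; exact: stick_ge0.
- move=> l kl.
  have : (d + 2)%:R * nbr_mean d (stick d A i) (w l.+1, l.+1) <=
      (d + 2)%:R * a l.+1.
    by rewrite ler_pM2l ?ltr0n ?addn2//; apply: stick_superharmonic => /=; lia.
  rewrite nbr_meanM/= natrD => H.
  have : \sum_(u | adj (w l.+1) u) a l.+1 <=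
      \sum_(u | adj (w l.+1) u) stick d A i (u, l.+1).
    by apply: ler_sum => u _; exact: aP.
  rewrite (sum_adj_const Greg).
  have := aP (w l.+1) l; have := aP (w l.+1) l.+2; lra.
Qed.

(** Each step of the path inside layer [k] is taken with probability
    [(d + 2)^-1], and the hypothesis on the layers from [k.-1] on controls what
    happens when the walk leaves the path. *)
Lemma stick_path i k U v p : (i < k)%N -> 0 <= U ->
  (forall u j, (k.-1 <= j)%N -> 1 - U <= stick d A i (u, j)) ->
  path adj v p -> (last v p, k) \in hull A ->
  1 - (1 - (d + 2)%:R ^- size p) * U <= stick d A i (v, k).
Proof.
move=> ik U0 lowU; have d2 : 0 < (d + 2)%:R :> R by rewrite ltr0n addn2.
have d2V : 0 < ((d + 2)%:R : R)^-1 <= 1.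
  by rewrite invr_gt0 d2 invf_le1 // ler1n addn2.
elim: p v => [|u p IH] v /=.
  by move=> _ vA; rewrite stick_in// ik expr0 invr1 subrr mul0r subr0.
move=> /andP[vu pu] /(IH _ pu) {}IH.
set q := (d + 2)%:R ^- size p in IH.
have q01 : 0 <= q <= 1.
  by rewrite /q -exprVn exprn_ge0 ?exprn_ile1 ?(ltW (andP d2V).1) ?(andP d2V).2.
have [vA|vA] := boolP ((v, k) \in hull A).
  rewrite stick_in// ik lerBlDr lerDl mulr_ge0// subr_ge0 -exprVn.
  by rewrite exprn_ile1 ?(ltW (andP d2V).1) ?(andP d2V).2.
(* One neighbour is the next point of the path, the others get [1 - U]. *)
rewrite stick_out// -(ler_pM2l d2) nbr_meanM/=.
have -> : (d + 2)%:R * (1 - (1 - (d + 2)%:R ^- (size p).+1) * U) =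
    (d + 2)%:R * (1 - U) + q * U.
  rewrite /q exprS invfM; field.
  by rewrite expf_neq0 /= gt_eqF.
rewrite (bigD1 u)//=.
have : \sum_(w | adj v w && (w != u)) (1 - U) <=
    \sum_(w | adj v w && (w != u)) stick d A i (w, k).
  by apply: ler_sum => w _; apply: lowU; rewrite leq_pred.
have := sum_adj_const Greg v (1 - U); rewrite (bigD1 u)//=.
have := lowU v k.+1 (leq_trans (leq_pred _) (leqnSn _)).
have := lowU v k.-1 (leqnn _).
by rewrite natrD; lra.
Qed.

(** Each occupied layer stops a walk descending through it with probability at
    least the constant subtracted here, so deep descents are exponentially
    unlikely. *)
Lemma stick_deep m : connected_graph G -> (m <= M)%N -> forall v,
  1 - (1 - (d + 2)%:R ^- #|G|) ^+ (M - m) <= stick d A m (v, M).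
Proof.
move=> [G0 Gconn] mM.
have d2 : 0 < (d + 2)%:R :> R by rewrite ltr0n addn2.
have d2V : 0 < ((d + 2)%:R : R)^-1 <= 1.
  by rewrite invr_gt0 d2 invf_le1 // ler1n addn2.
have d2Vn l : 0 <= 1 - (d + 2)%:R ^- l :> R.
  by rewrite subr_ge0 -exprVn exprn_ile1 ?(ltW (andP d2V).1) ?(andP d2V).2.
suff H k : (m + k <= M)%N -> forall v j, (m + k <= j)%N ->
    1 - (1 - (d + 2)%:R ^- #|G|) ^+ k <= stick d A m (v, j).
  by move=> v; apply: H; rewrite subnKC.
elim: k => [|k IH] kM v j kj; first by rewrite expr0 subrr stick_ge0.
move: v j kj; have mk : (m <= m + k.+1)%N by lia.
apply: (stick_above mk) => // v.
have /load_gt0P[s As] : (0 < load A (m + k)%N)%N by rewrite AM.2; lia.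
have /connectP[p0 p0v] := Gconn v s.
case: (shortenP p0v) => p pv p_uniq _ sE.
have sp : (size p <= #|G|)%N.
  have /card_uniqP cp := p_uniq.
  by apply: leq_trans (leqnSn _) _; rewrite -[(size p).+1]/(size (v :: p)) -cp max_card.
apply: le_trans (stick_path (U := (1 - (d + 2)%:R ^- #|G|) ^+ k) _ _ _ pv _).
- rewrite lerD2l lerN2 exprS ler_wpM2r ?exprn_ge0// lerD2l lerN2.
  by rewrite -!exprVn ler_wiXn2l ?(ltW (andP d2V).1) ?(andP d2V).2.
- lia.
- by rewrite exprn_ge0.
- by move=> u j; rewrite addnS /=; apply: IH; lia.
- by rewrite -sE addnS inE; exact: up_hull.
Qed.

End Fixed.
End Cluster.

(** * Escape up to the mixing time *)

(** [B s j] is the value seen by a lazy walk at height [j] after [s] horizontal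
    moves, and [m] is a lower bound for it once the walk has mixed. Up to the
    factor [m / (4 * kappa ^ 3)] it is bounded below by
    [w s j = j * (2 * kappa ^ 2 - j ^ 2 + 6 * s / (d + 1))], a combination of the
    martingales [j] and [j ^ 3 - 6 * s * j / (d + 1)] of this walk; so the walk
    mixes before it comes down with probability of the order of [1 / kappa]. *)
Lemma escape_lower_bound (R : realType) (d kappa tau : nat) (m : R)
    (B : nat -> nat -> R) :
  (2 <= d)%N -> (0 < kappa)%N -> (tau <= kappa ^ 2)%N -> 0 <= m ->
  (forall s j, 0 <= B s j) ->
  (forall s j, (j.+1 < 2 * kappa)%N ->
     (d + 3)%:R * B s j.+1 = (d + 1)%:R * B s.+1 j.+1 + B s j.+2 + B s j) ->
  (forall j, (0 < j < 2 * kappa)%N -> m <= B tau j) ->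
  m <= (4 * kappa)%:R * B 0%N 1%N.
Proof.
move=> d2 k0 tk m0 B0 Brec Btau.
have kr : 1 <= kappa%:R :> R by rewrite ler1n.
have dr : 2 <= d%:R :> R by rewrite ler_nat.
set k : R := kappa%:R in kr *.
pose c := m / (4 * k ^+ 3).
have c0 : 0 <= c by rewrite divr_ge0// mulr_ge0// exprn_ge0//; lra.
have cE : c * (4 * k ^+ 3) = m.
  by rewrite /c divfK// mulf_neq0// expf_neq0//; lra.
pose al : R := 6 / (d + 1)%:R.
have d1 : (d + 1)%:R * al = 6 by rewrite /al mulrC divfK// pnatr_eq0 addn1.
have al2 : al <= 2.
  by rewrite /al ler_pdivrMr ?ltr0n ?addn1// -natr1; lra.
have al0 : 0 <= al by rewrite /al divr_ge0.
pose w (s j : nat) : R := j%:R * (2 * k ^+ 2 - j%:R ^+ 2 + al * s%:R).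
pose E s j := B s j - c * w s j.
have wS s j : (d + 3)%:R * w s j.+1 = (d + 1)%:R * w s.+1 j.+1 + w s j.+2 + w s j.
  have -> : (d + 3)%:R = (d + 1)%:R + 2 :> R by rewrite -natrD -addnA.
  rewrite /w -!(@natr1 R j.+1) -!(@natr1 R j) -!(@natr1 R s).
  set D := (d + 1)%:R in d1 *.
  set x := j%:R; set y := s%:R.
  apply/eqP; rewrite -subr_eq0; apply/eqP.
  rewrite [LHS](_ : _ = (x + 1) * (6 - D * al)); last by ring.
  by rewrite d1 subrr mulr0.
have tkr : tau%:R <= k ^+ 2 by rewrite /k -natrX ler_nat.
(* Maximum principle on [0 <= j <= 2 * kappa], by downward induction on [s]. *)
have EK r : (r <= tau)%N -> forall j, (j <= 2 * kappa)%N -> 0 <= E (tau - r)%N j.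
  elim: r => [|r IH] rt j jk.
    rewrite subn0 /E subr_ge0.
    have alt : al * tau%:R <= 2 * k ^+ 2 by have : 0 <= tau%:R :> R by []; nra.
    have jr : 0 <= j%:R :> R by [].
    have jr2 : j%:R <= 2 * k by rewrite /k -natrM ler_nat.
    have wle : w tau j <= j%:R * (4 * k ^+ 2 - j%:R ^+ 2).
      by rewrite /w ler_wpM2l//; lra.
    have [j0|j0] := posnP j.
      by apply: le_trans (B0 _ _); rewrite /w j0 mul0r mulr0.
    have [jlt|jge] := ltnP j (2 * kappa)%N.
      apply: (@le_trans _ _ m); last by apply: Btau; rewrite j0.
      rewrite -cE ler_wpM2l//; apply: le_trans wle _.
      (* The maximum of [x (4 - x ^ 2)] for [0 <= x <= 2] is less than 4. *)
      rewrite -subr_ge0.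
      rewrite [leRHS](_ : _ = (j%:R - k) ^+ 2 * (j%:R + 2 * k) +
        k ^+ 2 * (2 * k - j%:R)); last by ring.
      by rewrite addr_ge0// mulr_ge0 ?sqr_ge0//; lra.
    apply: le_trans (B0 _ _); rewrite mulr_ge0_le0//.
    have -> : j = (2 * kappa)%N by lia.
    rewrite /w mulr_ge0_le0//; rewrite natrM -/k; lra.
  have IHr := IH (ltnW rt); have sE : (tau - r)%N = (tau - r.+1).+1 by lia.
  rewrite sE in IHr; set s := (tau - r.+1)%N in IHr *.
  apply: (@concave_boundary_ge0 R (E s) (2 * kappa)%N) => //.
  - by rewrite /E /w mul0r mulr0 subr0.
  - rewrite /E subr_ge0; apply: le_trans (B0 _ _); rewrite mulr_ge0_le0//.
    rewrite /w mulr_ge0_le0//; rewrite natrM -/k.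
    have : s%:R <= k ^+ 2.
      by apply: le_trans tkr; rewrite ler_nat leq_subr.
    have : 0 <= s%:R :> R by []; nra.
  - move=> i ik Ei; have := IHr i.+1 (ltnW ik).
    have := Brec s i ik; have := wS s i.
    have Dr : (d + 3)%:R = (d + 1)%:R + 2 :> R by rewrite -natrD -addnA.
    have D0 : 0 <= (d + 1)%:R :> R by [].
    move=> ws Bs Es.
    have EE : (d + 3)%:R * E s i.+1 = (d + 1)%:R * E s.+1 i.+1 + E s i.+2 + E s i.
      by rewrite /E mulrBr mulrCA ws Bs; ring.
    have := mulr_ge0 D0 Es; have := mulr_ge0_le0 D0 (ltW Ei).
    by move: EE; rewrite Dr; lra.
have k1 : (1 <= 2 * kappa)%N by lia.
have := EK tau (leqnn _) 1%N k1; rewrite subnn /E subr_ge0.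
rewrite /w mul1r expr1n mulr0 addr0 => H.
have k2 : 1 <= k ^+ 2 by rewrite expr_ge1//; lra.
have : c * k ^+ 2 <= B 0%N 1%N by apply: le_trans H; rewrite ler_wpM2l//; lra.
move=> H2; rewrite -cE natrM -/k.
have k4 : 0 <= 4 * k by lra.
apply: le_trans (ler_wpM2l k4 H2).
by rewrite (_ : 4 * k * (c * k ^+ 2) = c * (4 * k ^+ 3)) //; ring.
Qed.

(** * The Green identity and the lazy walk *)

Section GreenIdentity.
Variables (R : realType) (G : sgraph) (d : nat).

Lemma sum_adj_symm (f g : G -> R) :
  \sum_v f v * \sum_(u | adj v u) g u = \sum_v g v * \sum_(u | adj v u) f u.
Proof.
under eq_bigr do rewrite mulr_sumr.
rewrite (exchange_big_dep xpredT)//=; apply: eq_bigr => u _.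
by rewrite mulr_sumr; apply: eq_big => v; [rewrite adj_sym|rewrite mulrC].
Qed.

(** Horizontally the mean is self-adjoint; vertically the sum telescopes, and the
    boundary terms vanish because [F] does on two layers at each end. *)
Lemma green_identity (F H : cyl G -> R) p q : (p <= q)%N ->
  (forall v, F (v, p) = 0) -> (forall v, F (v, p.+1) = 0) ->
  (forall v, F (v, q) = 0) -> (forall v, F (v, q.+1) = 0) ->
  \sum_(p <= i < q) \sum_v (F (v, i.+1) * nbr_mean d H (v, i.+1) -
                            H (v, i.+1) * nbr_mean d F (v, i.+1)) = 0.
Proof.
move=> pq Fp FpS Fq FqS.
pose T i := \sum_v (F (v, i) * H (v, i.+1) - H (v, i) * F (v, i.+1)).
transitivity ((T q - T p) / (d + 2)%:R); last first.
  by rewrite /T !big1 ?subrr ?mul0r// => v _; rewrite ?Fp ?FpS ?Fq ?FqS; ring.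
rewrite -telescope_sumr// mulr_suml; apply: eq_bigr => i _.
have D0 : (d + 2)%:R != 0 :> R by rewrite pnatr_eq0 addn2.
apply: (mulfI D0); rewrite [RHS]mulrC divfK//.
rewrite mulr_sumr.
under eq_bigr => v _ do rewrite mulrBr mulrCA nbr_meanM mulrCA nbr_meanM/=.
rewrite /T -sumrB.
have := sum_adj_symm (fun v => F (v, i.+1)) (fun v => H (v, i.+1)).
move/eqP; rewrite -subr_eq0 -sumrB => /eqP symm.
rewrite -[RHS]addr0 -[X in _ = _ + X]symm -big_split/=; apply: eq_bigr => v _.
by ring.
Qed.

End GreenIdentity.

Section LazyAverage.
Variables (R : realType) (G : sgraph) (d : nat).
Hypothesis Greg : regular d G.

(** The expected value of [f] after [s] steps of the lazy walk from [v]. *)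
Definition lazy_mean s (f : G -> R) v : R := \sum_u lazy_prob R s v u * f u.

Lemma lazy_mean0 f v : lazy_mean 0 f v = f v.
Proof.
rewrite /lazy_mean (bigD1 v)//= eqxx mul1r big1 ?addr0// => u /negPf uv.
by rewrite eq_sym uv mul0r.
Qed.

Lemma lazy_meanS s f v :
  (d + 1)%:R * lazy_mean s.+1 f v =
  lazy_mean s f v + \sum_(u | adj v u) lazy_mean s f u.
Proof.
transitivity ((d + 1)%:R * \sum_w lazy_step R v w * lazy_mean s f w).
  congr (_ * _); rewrite /lazy_mean /=.
  under eq_bigr do rewrite mulr_suml.
  rewrite exchange_big/=; apply: eq_bigr => w _.
  by rewrite mulr_sumr; apply: eq_bigr => u _; rewrite mulrA.
rewrite mulr_sumr (bigD1 v)//= /lazy_step Greg eqxx /= addn1.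
have D0 : d.+1%:R != 0 :> R by rewrite pnatr_eq0.
rewrite mul1r mulrA mulfV// mul1r; congr (_ + _).
rewrite [RHS]big_mkcond [RHS](bigD1 v)//= adj_irr add0r; apply: eq_bigr => u uv.
rewrite eq_sym (negPf uv)/=; case: (adj v u) => /=.
  by rewrite mul1r mulrA mulfV// mul1r.
by rewrite !(mul0r, mulr0).
Qed.

End LazyAverage.

(** * Growth of a cluster with a light top *)

Section Light.
Variables (R : realType) (G : sgraph) (d M : nat) (A : set (cyl G)).
Variables (h theta kappa tau omega : nat).
Hypothesis Greg : regular d G.
Hypothesis AM : is_cluster A M.
Hypothesis d2 : (2 <= d)%N.
Hypothesis hM : (h < M)%N.
Hypothesis light : forall j, (M - h <= j)%N -> (load A j <= theta)%N.
Hypothesis small : (4 * (d + 2) * (d + 3) * theta * h ^ 2 <= #|G|)%N.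
Hypothesis mixed : forall u v : G, (2 * #|G|%:R)^-1 <= lazy_prob R tau v u.
Hypothesis kappa0 : (0 < kappa)%N.
Hypothesis tau_kappa : (tau <= kappa ^ 2)%N.
Hypothesis h_kappa : (64 * omega * kappa <= h)%N.
Hypothesis omega0 : (0 < omega)%N.

Let D (x : cyl G) := (x \notin hull A) && (M - h < x.2 < M + h)%N.

(** The expected number of visits to layer [M] of the walk that is killed when
    it meets the hull or moves to vertical distance [h] from layer [M]. *)
Let F := green d D (fun x => (D x && (x.2 == M))%:R : R).

(* Without a cluster, the expected number of visits would be
   [(d + 2) / 2] times this function of the layer. *)
Let tent j := minn (j + h - M) (M + h - j).
Let b (x : cyl G) : R := (d + 2)%:R / 2 * (tent x.2)%:R.

Let h0 : (0 < h)%N. Proof. by apply: leq_trans h_kappa; rewrite !muln_gt0 omega0. Qed.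
Let hr : 1 <= h%:R :> R. Proof. by rewrite ler1n. Qed.
Let dr : 0 < (d + 2)%:R :> R. Proof. by rewrite ltr0n addn2. Qed.

Let b0 x : 0 <= b x.
Proof. by rewrite mulr_ge0// divr_ge0. Qed.

Let tent_concave j : (M - h < j < M + h)%N ->
  (tent j.+1 + tent j.-1 + 2 * (j == M) = 2 * tent j)%N.
Proof. by rewrite /tent => jh; case: eqP => ?; lia. Qed.

Let supb x : (D x && (x.2 == M))%:R + (if D x then nbr_mean d b x else 0) <= b x.
Proof.
case: ifP => Dx /=; last by rewrite addr0.
have /andP[_ xh] := Dx.
have tE : (tent x.2.+1)%:R + (tent x.2.-1)%:R + 2 * (x.2 == M)%:R =
    2 * (tent x.2)%:R :> R by rewrite -!natrM -!natrD tent_concave.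
rewrite -(ler_pM2l dr) mulrDr nbr_meanM /b/= (sum_adj_const Greg).
set q := (d + 2)%:R / 2.
have q2 : (d + 2)%:R = 2 * q by rewrite mulrC divfK.
have -> : d%:R = 2 * q - 2 by rewrite -q2 natrD addrK.
rewrite q2 -subr_ge0 [leRHS](_ : _ = q * (2 * (tent x.2)%:R -
  ((tent x.2.+1)%:R + (tent x.2.-1)%:R + 2 * (x.2 == M)%:R))); last by ring.
by rewrite tE subrr mulr0.
Qed.

Let g0 x : 0 <= (D x && (x.2 == M))%:R :> R. Proof. by []. Qed.

Let F0 x : 0 <= F x.
Proof. exact: (green_ge0 Greg g0 b0 supb). Qed.

Let Fb x : F x <= b x.
Proof. exact: (green_le Greg g0 b0 supb). Qed.

Let F_le x : F x <= (d + 2)%:R / 2 * h%:R.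
Proof.
apply: le_trans (Fb x) _; rewrite ler_wpM2l ?divr_ge0// ler_nat /tent; lia.
Qed.

Let F_out x : ~~ D x -> F x = 0.
Proof.
by move=> Dx; rewrite /F (greenE Greg g0 b0 supb) (negPf Dx)/= addr0.
Qed.

Let F_in x : D x -> F x = (x.2 == M)%:R + nbr_mean d F x.
Proof.
by move=> Dx; rewrite {1}/F (greenE Greg g0 b0 supb) Dx.
Qed.

Let nhull j := #|[pred v : G | (v, j) \in hull A]|.

Let nhull_le j : (M - h < j)%N -> (nhull j <= (d + 3) * theta)%N.
Proof.
move=> jh; rewrite -(ler_nat R).
pose I x : R := (x \in A)%:R.
have IL l : \sum_v I (v, l) = (load A l)%:R.
  by rewrite /load -sum1_card natr_sum [RHS]big_mkcond/=; apply: eq_bigr => v _; rewrite /I inE; case: ifP.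
have I0 x : 0 <= I x by rewrite /I.
apply: (@le_trans _ _ (\sum_v (I (v, j) + (d + 2)%:R * nbr_mean d I (v, j)))).
  rewrite /nhull -sum1_card natr_sum [leLHS]big_mkcond/=.
  apply: ler_sum => v _; rewrite nbr_meanM/=.
  have S0 : 0 <= \sum_(u | adj v u) I (u, j) by exact: sumr_ge0.
  have := I0 (v, j); have := I0 (v, j.+1); have := I0 (v, j.-1).
  rewrite inE; case: ifP => [|_]; last by lra.
  rewrite inE => /hull_adj[Av|[[u l] Au]].
    have : I (v, j) = 1 by rewrite /I mem_set.
    lra.
  have Iu : I (u, l) = 1 by rewrite /I mem_set.
  rewrite cyl_adj_layer => /orP[/andP[/eqP jl vu]|/andP[jl /eqP vu]].
    have : 1 <= \sum_(u | adj v u) I (u, j).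
      by rewrite (bigD1 u)//= jl Iu lerDl sumr_ge0.
    lra.
  rewrite -vu in Iu; move: jl => /orP[]/eqP jl; last by rewrite -jl Iu; lra.
  have : I (v, j.-1) = 1 by rewrite jl.
  lra.
rewrite big_split/= IL -mulr_sumr (sum_nbr_mean Greg) !IL.
have L l : (M - h <= l)%N -> (load A l)%:R <= theta%:R :> R.
  by move=> lh; rewrite ler_nat light.
have l1 := L j (ltnW jh); have l2 := L j.+1 (leq_trans (ltnW jh) (leqnSn _)).
have l3 : (load A j.-1)%:R <= theta%:R :> R by apply: L; lia.
have := ler_wpM2l (ler0n R d) l1; rewrite natrM natrD; lra.
Qed.

Let a j := \sum_v F (v, j).

(* Killing on the hull costs at most one more than the maximum of [F] per point. *)
Let sum_superharmonic j : (M - h < j < M + h)%N ->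
  (d + 2)%:R * (#|G|%:R * (j == M)%:R) + a j.+1 + a j.-1 <=
  2 * a j + (d + 2)%:R ^+ 2 * h%:R * ((d + 3)%:R * theta%:R).
Proof.
move=> jh; have /andP[jh1 jh2] := jh.
have : \sum_v ((j == M)%:R + nbr_mean d F (v, j)) <=
    \sum_v (F (v, j) + (d + 2)%:R * h%:R * ((v, j) \in hull A)%:R).
  apply: ler_sum => v _; case: (boolP (D (v, j))) => [Dv|].
    by rewrite F_in//= lerDl mulr_ge0 ?mulr_ge0.
  move=> Dv; rewrite F_out// add0r.
  have -> : (v, j) \in hull A by move: Dv; rewrite /D/= jh andbT negbK.
  rewrite mulr1.
  have : nbr_mean d F (v, j) <= (d + 2)%:R / 2 * h%:R.
    rewrite -[leRHS](nbr_mean_cst Greg _ (v, j)).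
    exact: le_nbr_mean.
  have : (j == M)%:R <= 1 :> R by rewrite lern1 leq_b1.
  have d2r : 2 <= d%:R :> R by rewrite ler_nat.
  have : 1 <= (d + 2)%:R / 2 * h%:R :> R.
    by apply: le_trans hr _; rewrite ler_peMl// natrD; lra.
  lra.
rewrite !big_split/= -mulr_sumr sumr_const cardT -cardE -mulr_natl.
have -> : \sum_v ((v, j) \in hull A)%:R = (nhull j)%:R :> R.
  by rewrite /nhull -sum1_card natr_sum [RHS]big_mkcond/=; apply: eq_bigr => v _; rewrite inE; case: ifP.
have nh : (nhull j)%:R <= (d + 3)%:R * theta%:R :> R.
  by rewrite -natrM ler_nat nhull_le.
have := ler_wpM2l (mulr_ge0 (ltW dr) (ltW (lt_le_trans ltr01 hr))) nh.
rewrite -(ler_pM2l dr (_ + \sum_v _)) !mulrDr (sum_nbr_mean Greg) -!/(a _).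
have drE : (d + 2)%:R = d%:R + 2 :> R by rewrite natrD.
move=> H1 H2; have := ler_wpM2l (ltW dr) H1; rewrite expr2.
move: H2; rewrite [X in X <= _]addrA.
move: (_ * ((d+2)%:R * h%:R * (nhull j)%:R)) => z.
by rewrite {4}drE; lra.
Qed.

(* The layer sums dominate a tent minus a parabola that absorbs the error term,
   by concavity of the difference between the two ends of the window. *)
Let layer_sum_ge i : (0 < i < 2 * kappa)%N ->
  #|G|%:R * ((d + 2)%:R * h%:R / 8) <= a (M + i)%N.
Proof.
move=> ik; have ih : (2 * i <= h)%N by nia.
pose Q : R := (d + 2)%:R / 2 * ((d + 2)%:R * h%:R * ((d + 3)%:R * theta%:R)).
pose l k := (M - h + k)%N.
pose E k := a (l k) - #|G|%:R * ((d + 2)%:R / 2) * (tent (l k))%:R +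
            Q * (k%:R * (2 * h%:R - k%:R)).
have : 0 <= E (h + i)%N.
  apply: (@concave_boundary_ge0 R E (2 * h)%N); last lia.
  - rewrite /E mul0r mulr0 addr0 /tent.
    rewrite (_ : minn _ _ = 0%N); last by rewrite /l; lia.
    by rewrite mulr0 subr0 sumr_ge0.
  - rewrite /E natrM subrr mulr0 mulr0 addr0 /tent.
    rewrite (_ : minn _ _ = 0%N); last by rewrite /l; lia.
    by rewrite mulr0 subr0 sumr_ge0.
  - move=> k kh _.
    have lk : (M - h < l k.+1 < M + h)%N by rewrite /l; lia.
    have := sum_superharmonic lk.
    have tE : (tent (l k.+1).+1)%:R + (tent (l k.+1).-1)%:R + 2 * (l k.+1 == M)%:R =
        2 * (tent (l k.+1))%:R :> R by rewrite -!natrM -!natrD tent_concave.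
    move: tE; have -> : (l k.+1).+1 = l k.+2 by rewrite /l !addnS.
    have -> : (l k.+1).-1 = l k by rewrite /l !addnS.
    rewrite /E -(@natr1 R k.+1) -(@natr1 R k) => tE; clear E.
    set n := #|G|%:R; set x := k%:R; set H := h%:R in Q *.
    set t0 := (tent _)%:R in tE *; set t1 := (tent _)%:R in tE *.
    set t2 := (tent _)%:R in tE *; set u := (_ == _)%:R in tE *.
    set p := (d + 2)%:R in Q *; set q := _ * theta%:R in Q *.
    have QE : p ^+ 2 * H * q = 2 * Q by rewrite /Q; field.
    rewrite QE => S; rewrite -subr_ge0.
    have S' := S; rewrite -subr_ge0 in S'.
    apply: le_trans S' _; rewrite -subr_ge0.
    rewrite [leRHS](_ : _ = n * (p / 2) *
      (t0 + t1 + 2 * u - 2 * t2)); last by field.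
    by rewrite tE subrr mulr0.
rewrite /E.
have -> : l (h + i)%N = (M + i)%N by rewrite /l; lia.
have tl : h%:R / 2 <= (tent (M + i))%:R :> R.
  have : h%:R <= (2 * tent (M + i))%:R :> R by rewrite ler_nat /tent; lia.
  by rewrite natrM; lra.
have Ql : Q * h%:R ^+ 2 <= #|G|%:R * ((d + 2)%:R * h%:R / 8).
  have : (4 * (d + 2) * (d + 3) * theta * h ^ 2)%:R <= #|G|%:R :> R.
    by rewrite ler_nat.
  have H0 : 0 <= (d + 2)%:R * h%:R / 8 :> R by rewrite divr_ge0// mulr_ge0.
  move/(ler_wpM2r H0); rewrite !natrM; apply: le_trans.
  by rewrite le_eqVlt; apply/orP; left; apply/eqP; rewrite /Q; field.
have Q0 : 0 <= Q by rewrite /Q !mulr_ge0 ?invr_ge0.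
have par : (h + i)%:R * (2 * h%:R - (h + i)%:R) <= h%:R ^+ 2 :> R.
  rewrite natrD -subr_ge0 [leRHS](_ : _ = i%:R ^+ 2); first exact: sqr_ge0.
  by ring.
have P0 : 0 <= #|G|%:R * ((d + 2)%:R / 2) :> R by rewrite mulr_ge0// divr_ge0.
have := ler_wpM2l Q0 par; have := ler_wpM2l P0 tl.
set n := #|G|%:R in Ql *; set p := (d + 2)%:R in Ql *; set H := h%:R in Ql *.
rewrite (_ : n * (p / 2) * (H / 2) = 2 * (n * (p * H / 8))); last by field.
lra.
Qed.

Let B v s i := lazy_mean s (fun u => F (u, (M + i)%N)) v.

Let B_ge0 v s i : 0 <= B v s i.
Proof.
apply: sumr_ge0 => u _; rewrite mulr_ge0//.
elim: s v u => [|s IH] v u //=; apply: sumr_ge0 => w _.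
by rewrite mulr_ge0// divr_ge0.
Qed.

Let B_rec v s i : (i.+1 < 2 * kappa)%N ->
  (d + 3)%:R * B v s i.+1 = (d + 1)%:R * B v s.+1 i.+1 + B v s i.+2 + B v s i.
Proof.
move=> ik; have ih : (i.+1 < h)%N by nia.
rewrite /B lazy_meanS//; elim: s v => [|s IH] v.
  under eq_bigr do rewrite lazy_mean0.
  have FE : F (v, (M + i.+1)%N) = nbr_mean d F (v, (M + i.+1)%N).
    rewrite F_in/=; last first.
      apply/andP; split => /=; last lia.
      by rewrite notin_setE; move=> /(hull_le AM)/=; lia.
    by rewrite (_ : _ == M = false) ?add0r//; apply/negP => /eqP; lia.
  have := nbr_meanM d F (v, (M + i.+1)%N); rewrite -FE !lazy_mean0 /=.
  rewrite (_ : (d + 3)%:R = (d + 2)%:R + 1); last by rewrite natr1 addnS.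
  by rewrite mulrDl => ->; rewrite !addnS/=; ring.
have D0 : (d + 1)%:R != 0 :> R by rewrite pnatr_eq0 addn1.
have avgS (f : G -> R) u : (d + 1)%:R * lazy_mean s.+1 f u =
  lazy_mean s f u + \sum_(w | adj u w) lazy_mean s f w.
  exact: lazy_meanS.
have sumS (f : G -> R) : (d + 1)%:R * \sum_(u | adj v u) lazy_mean s.+1 f u =
    \sum_(u | adj v u) (lazy_mean s f u + \sum_(w | adj u w) lazy_mean s f w).
  by rewrite mulr_sumr; apply: eq_bigr => u _; exact: avgS.
pose L k u := lazy_mean s (fun w => F (w, (M + k)%N)) u.
have sumIH : (d + 3)%:R * \sum_(u | adj v u) L i.+1 u =
    \sum_(u | adj v u) (L i.+1 u + \sum_(w | adj u w) L i.+1 w) +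
    \sum_(u | adj v u) L i.+2 u + \sum_(u | adj v u) L i u.
  by rewrite mulr_sumr -!big_split/=; apply: eq_bigr => u _; exact: IH.
apply: (mulfI D0); rewrite mulrCA !mulrDr sumS !avgS mulrDr IH.
move: sumIH; rewrite /L => ->; ring.
Qed.

(* After [tau] lazy steps the walk is nearly uniform, which turns the bound on the
   layer sums into a pointwise one. *)
Let F_escape v : h%:R * (d + 2)%:R <= (64 * kappa)%:R * F (v, M.+1).
Proof.
have n0 : 0 < #|G|%:R :> R by rewrite ltr0n; apply/card_gt0P; exists v.
have m0 : 0 <= (d + 2)%:R * h%:R / 16 :> R by rewrite divr_ge0// mulr_ge0.
have := escape_lower_bound d2 kappa0 tau_kappa m0 (B_ge0 v) (B_rec v).
have Bt j : (0 < j < 2 * kappa)%N -> (d + 2)%:R * h%:R / 16 <= B v tau j.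
  move=> jk; have := layer_sum_ge jk.
  rewrite mulrC -ler_pdivlMr// => H.
  apply: (@le_trans _ _ ((2 * #|G|%:R)^-1 * a (M + j)%N)).
    by rewrite invfM mulrAC -mulrA [2^-1 * _]mulrC; lra.
  rewrite /B /lazy_mean /a mulr_sumr; apply: ler_sum => u _.
  exact: ler_wpM2r.
move/(_ Bt); rewrite /B lazy_mean0 addn1 !natrM => H.
lra.
Qed.

(** When the top [h] layers are light, the new layer is reached with
    probability at least [omega / #|G|]. By the Green identity, the expected
    number of starting points from which the walk reaches a tip [(v, M)] is at
    least the expected number of later visits to layer [M] of a walk started at
    the tip. That walk first climbs for the mixing time, at the price of a factor
    of order [kappa], and then, being nearly uniform and meeting few particles,
    visits layer [M] of the order of [h] times. *)
Lemma light_sum_stick : omega%:R <= \sum_v stick R d A M.-1 (v, M).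
Proof.
have M0 : (0 < M)%N by lia.
have /load_gt0P[v0 Av0] : (0 < load A M.-1)%N by rewrite AM.2; lia.
have v0A : (v0, M) \in hull A by rewrite inE -(prednK M0); exact: up_hull.
have F_layer v j : ~~ (M - h < j < M + h)%N -> F (v, j) = 0.
  by move=> jh; apply: F_out; rewrite /D/= (negPf jh) andbF.
have := @green_identity R G d F (stick R d A M.-1) (M - h).-1 (M + h).
rewrite (_ : (M - h).-1.+1 = (M - h)%N); last by rewrite prednK ?subn_gt0.
have L1 : ((M - h).-1 <= M + h)%N by lia.
move=> /(_ L1 _ _ _ _)/esym; set S := \sum_(_ <= _ < _) _ => SE.
have {}SE : 0 = S by apply: SE => v; apply: F_layer; lia.
(* Off the hull both functions satisfy their equations; on it [F] vanishes, and
   only the term of the tip [(v0, M)] is kept. *)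
have : S <= \sum_((M - h).-1 <= i < M + h) \sum_v
   (if i == M.-1 then stick R d A M.-1 (v, M) - (if v == v0 then nbr_mean d F (v, M) else 0) else 0).
  apply: ler_sum_nat => i ih; apply: ler_sum => v _.
  have iM : (i == M.-1) = (i.+1 == M) by rewrite -[in RHS](prednK M0) eqSS.
  have P0 := nbr_mean_ge0 Greg (v, i.+1) F0.
  have S0 : 0 <= stick R d A M.-1 (v, i.+1) by exact: stick_ge0.
  have [Dv|Dv] := boolP (D (v, i.+1)).
    have /andP[vA _] := Dv; rewrite -(stick_out R Greg M.-1 vA) F_in//= iM.
    case: eqP => [iE|_]; last by rewrite add0r; lra.
    have /negPf -> : v != v0 by apply: contraNneq vA => ->; rewrite iE.
    by rewrite iE /=; lra.
  rewrite (F_out Dv) mul0r iM; have SP := mulr_ge0 S0 P0.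
  case: eqP => [iE|_]; last by lra.
  rewrite iE in S0 SP *; case: eqP => [vE|_]; last by lra.
  rewrite vE stick_in//= prednK// leqnn mul1r sub0r.
  by rewrite -subr_ge0 opprK subrK ler01.
rewrite -SE (bigD1_seq M.-1) ?iota_uniq//=; last by rewrite mem_index_iota; lia.
rewrite [X in _ + X]big1 ?addr0; last by move=> i /negPf ->; rewrite big1.
rewrite eqxx sumrB.
rewrite -big_mkcond big_pred1_eq subr_ge0; apply: le_trans.
have PF : F (v0, M.+1) <= (d + 2)%:R * nbr_mean d F (v0, M).
  by rewrite nbr_meanM/= -addrA addrCA lerDl addr_ge0 ?sumr_ge0.
have := F_escape v0; have hk : (64 * omega * kappa)%:R <= h%:R :> R by rewrite ler_nat.
have k0 : 0 < (64 * kappa)%:R :> R by rewrite ltr0n muln_gt0.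
move=> Fe; have := ler_wpM2l (ltW k0) PF => PF'.
have := le_trans Fe PF'; rewrite mulrC mulrCA ler_pM2l// => H.
have := le_trans hk H; rewrite mulnAC natrM ler_pM2l//.
Qed.

End Light.

(** * Adding a particle to a cluster *)

Section AddParticle.
Variable G : sgraph.
Variables (A : set (cyl G)) (M : nat) (y : cyl G).
Hypothesis AM : is_cluster A M.
Hypothesis yA : boundary A y.

Lemma load_add j : load (A `|` [set y]) j = (load A j + (y.2 == j))%N.
Proof.
rewrite /load; case: eqP => [yj|yj]; last first.
  rewrite addn0; apply: eq_card => v; rewrite !inE; apply/asboolP/asboolP; last by left.
  by case=> // vy; exfalso; apply: yj; rewrite -vy.
have y1 : y.1 \in [pred v : G | (v, j) \in A `|` [set y]].
  by rewrite !inE; right; rewrite -yj; case: (y).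
rewrite [RHS]addn1 (cardD1 y.1) y1 add1n; congr _.+1; apply: eq_card => v; rewrite !inE.
apply/andP/idP => [[vy /set_mem[Av|vjy]]|/set_mem Av]; first exact: mem_set.
  by exfalso; move/eqP: vy; apply; rewrite -vjy.
split; last by apply: mem_set; left.
apply/eqP => vy; case: yA => + _; apply.
by move: Av; rewrite vy -yj; case: (y).
Qed.

Lemma boundary_layer : (0 < y.2 <= M)%N.
Proof.
rewrite (hull_le AM) ?andbT; last by right.
case: (y) yA => v [|//] [] + _; by move=> /(_ (AM.1 v)).
Qed.

Lemma is_cluster_add :
  is_cluster (A `|` [set y]) (if y.2 == M then M.+1 else M).
Proof.
split=> [v|j]; first by left; exact: AM.1.
have /andP[_ yM] := boundary_layer.
rewrite load_add addn_gt0 AM.2 lt0b.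
case: (eqVneq y.2 M) => [yE|yE]; case: (eqVneq y.2 j) => [yj|yj]; rewrite ?orbT ?orbF.
- by rewrite -yj yE ltnSn.
- by rewrite ltnS [in RHS]leq_eqVlt -yE eq_sym (negPf yj).
- by rewrite -yj ltn_neqAle yE yM.
- by [].
Qed.

End AddParticle.

Lemma is_cluster_first_empty (G : sgraph) (A : set (cyl G)) M :
  is_cluster A M -> is_first_empty_layer A M.
Proof.
move=> [_ AM]; have E j : layer j `&` A = set0 <-> load A j = 0%N.
  split=> [jA|/eqP].
    apply/eqP; rewrite -leqn0 leqNgt; apply/negP => /load_gt0P[v Av].
    have : (layer j `&` A) (v, j) by split.
    by rewrite jA.
  rewrite -leqn0 leqNgt => /negP lA; apply/seteqP; split=> [[v k] [/= kj Av]|//].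
  by apply: lA; apply/load_gt0P; exists v; rewrite -kj.
split=> [|j /= /E jA]; first by apply/E/eqP; rewrite -leqn0 leqNgt AM ltnn.
by have := AM j; rewrite jA ltnn => /esym/negbT; rewrite -leqNgt.
Qed.

Definition height (G : sgraph) (A : set (cyl G)) : nat :=
  xget 0%N [set i | is_first_empty_layer A i].

Lemma is_min_uniq S i j : is_min S i -> is_min S j -> i = j.
Proof.
by move=> [Si mi] [Sj mj]; apply/eqP; rewrite eqn_leq mi//= mj.
Qed.

Lemma heightE (G : sgraph) (A : set (cyl G)) M : is_cluster A M -> height A = M.
Proof.
move/is_cluster_first_empty => AM; rewrite /height.
by case: xgetP => [i _ Ai|/(_ M)//]; exact: is_min_uniq Ai AM.
Qed.

(** Otherwise every layer of load at least [B ^ k] would have a layer of load at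
    least [B ^ k.-1] above it, and [h] steps up lead beyond the cluster. *)
Lemma exists_load_drop (G : sgraph) (A : set (cyl G)) (M B h j : nat) :
  is_cluster A M -> (0 < B)%N -> (M - h <= j < M)%N -> (B ^ h <= load A j)%N ->
  exists k i, [/\ (0 < k <= h)%N, (i < M)%N, (B ^ k <= load A i)%N &
    forall l, (i < l)%N -> (load A l < B ^ k.-1)%N].
Proof.
move=> AM B0 /andP[jh jM] hj; apply: contrapT => none.
have rec r : (r <= h)%N ->
    exists i, [/\ (M - h + r <= i)%N, (i < M)%N & (B ^ (h - r) <= load A i)%N].
  elim: r => [|r IH] rh; first by exists j; rewrite addn0 subn0.
  have [i [i1 i2 i3]] := IH (ltnW rh).
  have [lo|] := pselect (forall l, (i < l)%N -> (load A l < B ^ (h - r).-1)%N).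
    exfalso; apply: none; exists (h - r)%N, i; split => //; lia.
  move=> /existsNP[l] /not_implyP[il /negP]; rewrite -leqNgt => lB.
  have lr : ((h - r).-1 = h - r.+1)%N by lia.
  exists l; split; [lia| |by rewrite -lr].
  by rewrite -AM.2; apply: leq_trans lB; rewrite expn_gt0 B0.
have [i [i1 i2 _]] := rec h (leqnn h); lia.
Qed.

(** * Potentials and their drift *)

Section Potential.
Variables (R : realType) (G : sgraph) (d : nat) (omega h kappa tau m : nat).
Hypothesis Greg : regular d G.
Hypothesis Gconn : connected_graph G.
Hypothesis d2 : (2 <= d)%N.
Hypothesis mixed : forall u v : G, (2 * #|G|%:R)^-1 <= lazy_prob R tau v u.
Hypothesis kappa0 : (0 < kappa)%N.
Hypothesis tau_kappa : (tau <= kappa ^ 2)%N.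
Hypothesis h_kappa : (64 * omega * kappa <= h)%N.
Hypothesis omega0 : (0 < omega)%N.

(** The ratio of consecutive load thresholds. *)
Definition ratio := (omega * h)%N.

Hypothesis small : (4 * (d + 2) * (d + 3) * ratio ^ h * h ^ 2 <= #|G|)%N.

Let B := ratio.
Let n : R := #|G|%:R.

(** The rate of decay of the probability of a descent, per occupied layer. *)
Definition trap_rate : R := (d + 2)%:R ^- #|G|.

Let c := trap_rate.

(** Opening the layer adds the first term; the truncated loads grow when
    particles gather above a drop of the load. All the thresholds are summed as
    the level of the drop depends on the cluster, and the weights make every
    truncated load at most [ratio ^ h]. *)
Definition layer_potential (l : nat) : nat :=
  (h * B ^ h * (0 < l) + \sum_(k < h) B ^ (h - k) * minn l (B ^ k))%N.

Definition low_potential (A : set (cyl G)) : R :=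
  n / (B * B ^ h)%:R * (\sum_(j < m.+1) layer_potential (load A j))%:R.

(** Its growth pays for the particles that come back below layer [m] after the
    cluster has left the layers up to [m]. *)
Definition high_potential (A : set (cyl G)) : R :=
  n / c * (1 - (1 - c) ^+ (height A - m)).

(** The probability that the next particle sticks above layer [i], as its walk
    starts uniformly on the first empty layer. *)
Definition stick_mean (A : set (cyl G)) i : R := n^-1 * \sum_v stick R d A i (v, height A).

Let h0 : (0 < h)%N. Proof. by apply: leq_trans h_kappa; rewrite !muln_gt0 omega0. Qed.
Let B0 : (0 < B)%N. Proof. by rewrite muln_gt0 omega0. Qed.
Let n0 : 0 < n. Proof. by rewrite ltr0n; exact: Gconn.1. Qed.
Let Bh : (B ^ h <= #|G|)%N.
Proof.
apply: leq_trans small; rewrite mulnAC leq_pmull// !muln_gt0 !addn_gt0 !orbT.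
by rewrite h0.
Qed.

Let c01 : 0 < c <= 1.
Proof.
have d2r : 1 <= (d + 2)%:R :> R by rewrite ler1n addn2.
rewrite /c /trap_rate invr_gt0 exprn_gt0 ?(lt_le_trans _ d2r)//=.
by rewrite invf_le1 ?exprn_ege1// exprn_gt0// (lt_le_trans _ d2r).
Qed.

Lemma layer_potential_nd l l' : (l <= l')%N ->
  (layer_potential l <= layer_potential l')%N.
Proof.
move=> ll; apply: leq_add.
  by rewrite leq_mul//; case: l ll => // l; case: l'.
by apply: leq_sum => k _; rewrite leq_mul// leq_min geq_minr andbT (leq_trans (geq_minl _ _)).
Qed.

Lemma layer_potential_le l : (layer_potential l <= 2 * (h * B ^ h))%N.
Proof.
rewrite mul2n -addnn leq_add//; first by rewrite -[leqRHS]muln1 leq_mul// leq_b1.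
have -> : (h * B ^ h = \sum_(k < h) B ^ h)%N by rewrite sum_nat_const card_ord.
apply: leq_sum => k _.
apply: (@leq_trans (B ^ (h - k) * B ^ k)); first by rewrite leq_mul// geq_minr.
by rewrite -expnD subnK// ltnW.
Qed.

(** Below the threshold, a particle counts fully in the truncated load. *)
Lemma layer_potential_drop k l : (0 < k <= h)%N -> (l < B ^ k.-1)%N ->
  (layer_potential l + B ^ (h - k.-1) <= layer_potential l.+1)%N.
Proof.
move=> /andP[k0 kh] lk; have k1h : (k.-1 < h)%N by rewrite prednK.
rewrite /layer_potential -addnA leq_add//; first by rewrite leq_mul//; case: (l).
rewrite (bigD1 (Ordinal k1h))//= [leqRHS](bigD1 (Ordinal k1h))//= addnAC.
apply: leq_add.
  by rewrite !(minn_idPl _)// ?(ltnW lk)// mulnS addnC.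
apply: leq_sum => i _; rewrite leq_mul// leq_min geq_minr andbT.
by rewrite (leq_trans (geq_minl _ _)).
Qed.

Lemma low_potential_ge0 A : 0 <= low_potential A.
Proof. by rewrite mulr_ge0// divr_ge0// ltW. Qed.

Lemma low_potential_le A :
  low_potential A <= n * (2 * m.+1%:R / omega%:R).
Proof.
rewrite /low_potential.
have : (\sum_(j < m.+1) layer_potential (load A j) <= m.+1 * (2 * (h * B ^ h)))%N.
  rewrite -[m.+1 in leqRHS]card_ord -sum_nat_const; apply: leq_sum => j _.
  exact: layer_potential_le.
rewrite -(ler_nat R) => H.
have w0 : 0 <= n / (B * B ^ h)%:R by rewrite divr_ge0// ltW.
apply: le_trans (ler_wpM2l w0 H) _.
rewrite le_eqVlt; apply/orP; left; apply/eqP; rewrite /B /ratio !natrM; field.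
by rewrite !pnatr_eq0 -!lt0n expn_gt0 h0 omega0 muln_gt0 omega0 h0.
Qed.

Lemma high_potential_ge0 A : 0 <= high_potential A.
Proof.
have /andP[c0 c1] := c01.
rewrite mulr_ge0 ?divr_ge0 ?(ltW n0) ?(ltW c0)// subr_ge0 exprn_ile1//; lra.
Qed.

Lemma high_potential_le A : high_potential A <= n / c.
Proof.
have /andP[c0 c1] := c01.
rewrite ler_piMr ?divr_ge0 ?(ltW n0) ?(ltW c0)// lerBlDr lerDl exprn_ge0//; lra.
Qed.

Section Drift.
Variables (A : set (cyl G)) (M : nat).
Hypothesis AM : is_cluster A M.

Lemma low_potential_nd y : boundary A y ->
  low_potential A <= low_potential (A `|` [set y]).
Proof.
move=> yA; rewrite ler_wpM2l ?divr_ge0 ?(ltW n0)// ler_nat leq_sum// => j _.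
by rewrite layer_potential_nd// load_add// leq_addr.
Qed.

Lemma high_potential_nd y : boundary A y ->
  high_potential A <= high_potential (A `|` [set y]).
Proof.
move=> yA; have /andP[c0 c1] := c01.
rewrite ler_wpM2l ?divr_ge0 ?(ltW n0) ?(ltW c0)// lerD2l lerN2.
rewrite (heightE AM) (heightE (is_cluster_add AM yA)).
by rewrite ler_wiXn2l ?leq_sub2r//; [lra|lra|case: ifP].
Qed.

Lemma low_potential_add y w : boundary A y -> (y.2 <= m)%N ->
  (layer_potential (load A y.2) + w <= layer_potential (load A y.2).+1)%N ->
  low_potential A + n / (B * B ^ h)%:R * w%:R <=
  low_potential (A `|` [set y]).
Proof.
move=> yA ym; rewrite -ltnS in ym => Hw.
rewrite -mulrDr ler_wpM2l ?divr_ge0 ?(ltW n0)// -natrD ler_nat.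
rewrite (bigD1 (Ordinal ym))//= [leqRHS](bigD1 (Ordinal ym))//= addnAC leq_add//.
  by rewrite load_add// eqxx addn1.
by apply: leq_sum => j _; rewrite layer_potential_nd// load_add// leq_addr.
Qed.

(** Either a layer of the window is heavy and particles gather above a drop of the
    load, or the window is light and a new layer opens. A window that reaches
    layer 0 is heavy, since that layer is full. *)
Lemma low_drift : (M <= m)%N -> exists i w, [/\ 0 <= w,
  1 <= w * stick_mean A i & forall y, boundary A y ->
  low_potential A + w * (i < y.2)%:R <= low_potential (A `|` [set y])].
Proof.
move=> Mm; have lt_M y : boundary A y -> (y.2 <= M)%N.
  by move=> yA; have /andP[] := boundary_layer AM yA.
have BB0 : 0 < (B * B ^ h)%:R :> R by rewrite ltr0n muln_gt0 expn_gt0 B0.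
have Br : 0 < (omega%:R : R) by rewrite ltr0n.
have h0r : h%:R != 0 :> R by rewrite pnatr_eq0 -lt0n.
have Bhr : (B ^ h)%:R != 0 :> R by rewrite pnatr_eq0 -lt0n expn_gt0 B0.
have [[j [jM jB]]|light] :=
    pselect (exists j, (M - h <= j < M)%N /\ (B ^ h <= load A j)%N).
  have [k [i [kh iM ik lo]]] := exists_load_drop AM B0 jM jB.
  exists i, (n / (B * B ^ h)%:R * (B ^ (h - k.-1))%:R); split.
  - by rewrite mulr_ge0 ?divr_ge0 ?(ltW n0).
  - have : (B ^ k)%:R <= \sum_v stick R d A i (v, M).
      by apply: le_trans (@load_le_sum_stick R G d M A Greg i iM); rewrite ler_nat.
    rewrite /stick_mean (heightE AM) => S.
    have w0 : 0 <= n / (B * B ^ h)%:R * (B ^ (h - k.-1))%:R / n.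
      by rewrite divr_ge0 ?mulr_ge0 ?divr_ge0 ?(ltW n0).
    rewrite mulrA; apply: le_trans (ler_wpM2l w0 S).
    rewrite le_eqVlt; apply/orP; left; apply/eqP.
    have E : (B * B ^ h = B ^ (h - k.-1) * B ^ k)%N.
      by rewrite -expnS -expnD; congr (_ ^ _)%N; lia.
    have Bk l : (B ^ l)%:R != 0 :> R by rewrite pnatr_eq0 -lt0n expn_gt0 B0.
    by rewrite E natrM; field; rewrite !Bk gt_eqF.
  - move=> y yA; case: ltnP => iy; last by rewrite mulr0 addr0 low_potential_nd.
    rewrite mulr1; apply: low_potential_add => //.
      exact: leq_trans (lt_M y yA) Mm.
    by apply: layer_potential_drop; rewrite ?lo.
have hM : (h < M)%N.
  have load0 : load A 0 = #|G|.
    by apply: eq_card => v; rewrite !inE; apply/asboolP; exact: AM.1.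
  rewrite ltnNge; apply/negP => Mh; apply: light; exists 0%N.
  by rewrite load0 leqn0 subn_eq0 Mh -AM.2 load0 Gconn.1.
exists M.-1, (n / omega%:R); split.
- by rewrite divr_ge0 ?(ltW n0).
- have lo j : (M - h <= j)%N -> (load A j <= B ^ h)%N.
    move=> jh; have [jM|jM] := ltnP j M.
      rewrite leqNgt; apply/negP => jB; apply: light; exists j.
      by rewrite jh jM ltnW.
    by have := AM.2 j; rewrite (ltnNge j) jM /=; case: (load A j).
  have S := light_sum_stick Greg AM d2 hM lo small mixed kappa0 tau_kappa h_kappa omega0.
  have w0 : 0 <= n / omega%:R / n by rewrite !divr_ge0 ?(ltW n0).
  rewrite /stick_mean (heightE AM) mulrA; apply: le_trans (ler_wpM2l w0 S).
  by rewrite mulrAC divfK ?gt_eqF// mulfV// gt_eqF.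
- move=> y yA; case: ltnP => iy; last by rewrite mulr0 addr0 low_potential_nd.
  have yM : y.2 = M by apply/eqP; rewrite eqn_leq lt_M//= -(prednK (leq_trans h0 (ltnW hM))).
  have -> : n / omega%:R * 1 = n / (B * B ^ h)%:R * (h * B ^ h)%:R.
    have E : (B * B ^ h)%:R = omega%:R * h%:R * (B ^ h)%:R :> R by rewrite !natrM.
    by rewrite mulr1 E natrM; field; rewrite h0r Bhr gt_eqF.
  apply: low_potential_add; rewrite ?yM//.
  have -> : load A M = 0%N by apply/eqP; rewrite -leqn0 leqNgt AM.2 ltnn.
  rewrite /layer_potential muln0 add0n muln1 addnC leq_add2l.
  by apply: leq_sum => k _; rewrite min0n muln0.
Qed.

(** A new layer opens with probability at least [1 / #|G|]; the potential is
    chosen so that this compensates the bound of [stick_deep] on the probability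
    of coming back to the layers up to [m]. *)
Lemma high_drift : (m < M)%N -> exists i w, [/\ 0 <= w,
  1 - stick_mean A m <= w * stick_mean A i & forall y, boundary A y ->
  high_potential A + w * (i < y.2)%:R <= high_potential (A `|` [set y])].
Proof.
move=> mM; have /andP[c0 c1] := c01.
have M0 : (0 < M)%N := leq_ltn_trans (leq0n m) mM.
have b0 : 0 <= (1 - c) ^+ (M - m) by rewrite exprn_ge0//; lra.
exists M.-1, (n * (1 - c) ^+ (M - m)); split.
- by rewrite mulr_ge0// ltW.
- apply: (@le_trans _ _ ((1 - c) ^+ (M - m))).
    rewrite lerBlDr -lerBlDl /stick_mean (heightE AM) ler_pdivlMl//.
    rewrite /n -sum1_card natr_sum mulr_suml; apply: ler_sum => v _; rewrite mul1r.
    exact: (@stick_deep R G d M A Greg AM m Gconn (ltnW mM) v).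
  have S : 1 <= \sum_v stick R d A M.-1 (v, M).
    apply: le_trans (@load_le_sum_stick R G d M A Greg M.-1 _); last by rewrite prednK.
    by rewrite ler1n AM.2 prednK.
  rewrite /stick_mean (heightE AM) [leRHS](_ : _ = (1 - c) ^+ (M - m) *
    \sum_v stick R d A M.-1 (v, M)); last by field; rewrite gt_eqF.
  by rewrite ler_peMr.
- move=> y yA; case: ltnP => iy; last by rewrite mulr0 addr0 high_potential_nd.
  have yM : y.2 = M.
    apply/eqP; rewrite eqn_leq -{2}(prednK M0) iy andbT.
    by have /andP[] := boundary_layer AM yA.
  rewrite /high_potential (heightE AM) (heightE (is_cluster_add AM yA)) yM eqxx.
  rewrite subSn ?(ltnW mM)// exprS mulr1 le_eqVlt; apply/orP; left; apply/eqP.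
  by field; rewrite gt_eqF.
Qed.

End Drift.
End Potential.

(** * Measurability and finite additivity *)

Section CountableMeasurability.
Variables (disp : measure_display) (Omega : measurableType disp).

Lemma measurable_exists_countable (T : countType) (E : T -> set Omega) :
  (forall y, measurable (E y)) -> measurable [set w | exists y, E y w].
Proof.
move=> mE; rewrite (_ : [set w | _] =
    \bigcup_k (if unpickle k is Some y then E y else set0)).
  apply: bigcupT_measurable => k.
  by case: unpickle => [y|]; [exact: mE|exact: measurable0].
apply/seteqP; split=> w /=.
  by move=> [y Ey]; exists (pickle y) => //; rewrite pickleK.
by move=> [k _]; case: unpickle => // y Ey; exists y.
Qed.

Lemma measurable_forall_countable (T : countType) (E : T -> set Omega) :
  (forall y, measurable (E y)) -> measurable [set w | forall y, E y w].
Proof.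
move=> mE; rewrite (_ : [set w | _] = ~` [set w | exists y, (~` E y) w]).
  by apply/measurableC/measurable_exists_countable => y; exact: measurableC.
apply/seteqP; split=> w /= Ew; first by case=> y; apply.
by move=> y; apply: contrapT => nE; apply: Ew; exists y.
Qed.

Lemma measurable_constraint (Q : Prop) (E : set Omega) :
  measurable E -> measurable [set w | Q /\ E w].
Proof.
move=> mE; have [q|q] := pselect Q.
  by rewrite (_ : [set w | _] = E)//; apply/seteqP; split=> w //= [].
by rewrite (_ : [set w | _] = set0)//; apply/seteqP; split=> w //= [].
Qed.

End CountableMeasurability.

Section FiniteProbability.
Variables (R : realType) (disp : measure_display) (Omega : measurableType disp).
Variable P : probability Omega R.

Definition pr (E : set Omega) : R := fine (P E).

Lemma prE E : measurable E -> P E = (pr E)%:E.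
Proof. by move=> mE; rewrite /pr fineK// fin_num_measure. Qed.

Lemma pr_ge0 E : 0 <= pr E. Proof. exact: fine_ge0. Qed.

Lemma le_pr E F : measurable E -> measurable F -> E `<=` F -> pr E <= pr F.
Proof. by move=> mE mF EF; rewrite -lee_fin -!prE// le_measure ?inE. Qed.

Lemma prID E F : measurable E -> measurable F ->
  pr E = pr (E `&` F) + pr (E `&` ~` F).
Proof.
move=> mE mF; have mEF := measurableI _ _ mE mF.
have mEF' := measurableI _ _ mE (measurableC mF).
apply/EFin_inj; rewrite EFinD -!prE// -measureU//.
- by rewrite -setIUr setUv setIT.
- by rewrite setIACA setICr setI0.
Qed.

Lemma sum_pr_le (I : eqType) (T : Type) (f : I -> T) (X : Omega -> T) (s : seq I) E :
  (forall y, measurable [set w | X w = y]) -> injective f -> uniq s ->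
  measurable E -> \sum_(i <- s) pr (E `&` [set w | X w = f i]) <= pr E.
Proof.
move=> mX finj; elim: s E => [|i s IH] E; first by rewrite big_nil pr_ge0.
move=> /= /andP[is_ us] mE; rewrite big_cons (prID mE (mX (f i))) lerD2l.
have mE' := measurableI _ _ mE (measurableC (mX (f i))).
apply: le_trans (IH _ us mE'); rewrite !big_seq; apply: ler_sum => j js.
apply: le_pr; rewrite -?setIA; try (do ?apply: measurableI => //; exact: measurableC).
by move=> w [Ew Xw]; split=> //; split=> // Xwi; move: is_; rewrite (finj i j) ?js// -Xwi -Xw.
Qed.

End FiniteProbability.

(** * The particles of the process *)

Section Process.
Variables (R : realType) (G : sgraph) (d : nat).
Variables (disp : measure_display) (Omega : measurableType disp).
Variables (P : probability Omega R) (W : nat -> nat -> Omega -> cyl G).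
Hypothesis Greg : regular d G.
Hypothesis Gconn : connected_graph G.
Hypothesis dla : is_cylinder_dla P W.

Definition past (a : nat -> set (cyl G)) t : set Omega :=
  [set w | forall s, (s <= t)%N -> aggregate W s w = a s].

Definition hits t w r :=
  is_hitting_time (fun q => W t.+1 q w) (boundary (aggregate W t w)) r.

Definition sticks t (S : set (cyl G)) : set Omega :=
  [set w | exists r, hits t w r /\ S (W t.+1 r w)].

Lemma aggregateS_cases t w :
  (aggregate W t.+1 w = aggregate W t w /\ forall r, ~ hits t w r) \/
  exists r, [/\ hits t w r, boundary (aggregate W t w) (W t.+1 r w) &
    aggregate W t.+1 w = aggregate W t w `|` [set W t.+1 r w]].
Proof.
have [[r hr]|nh] := pselect (exists r, hits t w r); [right|left].
  exists r; split; [exact: hr|exact: hr.1|].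
  rewrite /=; congr (_ `|` _); apply/seteqP; split=> [_ [q hq <-]|_ ->]; last by exists r.
  by rewrite (is_min_uniq hq hr).
split; last by move=> r hr; apply: nh; exists r.
rewrite /= -[RHS]setU0; congr (_ `|` _); apply/seteqP; split=> // y [r hr _].
by apply: nh; exists r.
Qed.

Lemma is_cluster_aggregate t w : exists M, is_cluster (aggregate W t w) M.
Proof.
elim: t => [|t [M AM]].
  exists 1%N; split=> [//|j]; rewrite ltnS leqn0.
  apply/load_gt0P/eqP => [[v]//|->].
  by have /card_gt0P[v _] := Gconn.1; exists v.
have [[-> _]|[r [_ yA ->]]] := aggregateS_cases t w; first by exists M.
by eexists; exact: (is_cluster_add AM yA).
Qed.

Let mW t r (y : cyl G) : measurable [set w | W t.+1 r w = y].
Proof. exact: dla.1. Qed.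

Lemma measurable_boundary t y :
  (forall z, measurable [set w | aggregate W t w z]) ->
  measurable [set w | boundary (aggregate W t w) y].
Proof.
move=> mA; rewrite (_ : [set w | _] = ~` [set w | aggregate W t w y] `&`
    [set w | exists x : (G * nat)%type, cyl_adj x y /\ aggregate W t w x]).
  apply: measurableI; first exact: measurableC.
  apply: (@measurable_exists_countable _ _ (G * nat)%type
    (fun x => [set w | cyl_adj x y /\ aggregate W t w x])) => x.
  by apply: measurable_constraint; exact: mA.
apply/seteqP; split=> w /=.
  by move=> [nA [x Ax xy]]; split=> //; exists x.
by move=> [nA [x [xy Ax]]]; split=> //; exists x.
Qed.

Lemma measurable_hits t r :
  (forall z, measurable [set w | aggregate W t w z]) ->
  measurable [set w | hits t w r].
Proof.
move=> mA.
have mB q : measurable [set w | boundary (aggregate W t w) (W t.+1 q w)].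
  rewrite (_ : [set w | _] = [set w | exists y : (G * nat)%type,
      ([set w | W t.+1 q w = y] `&` [set w | boundary (aggregate W t w) y]) w]).
    apply: (@measurable_exists_countable _ _ (G * nat)%type
      (fun y => [set w | W t.+1 q w = y] `&`
                [set w | boundary (aggregate W t w) y])) => y.
    by apply: measurableI; [exact: mW|exact: measurable_boundary].
  apply/seteqP; split=> w /=; last by case=> y [<-].
  by move=> Bw; exists (W t.+1 q w).
rewrite (_ : [set w | _] = [set w | boundary (aggregate W t w) (W t.+1 r w)] `&`
    [set w | forall q, (~` [set w | (q < r)%N /\
       boundary (aggregate W t w) (W t.+1 q w)]) w]).
  apply: measurableI; first exact: mB.
  apply: (@measurable_forall_countable _ _ nat (fun q => ~` [set w | (q < r)%N /\
       boundary (aggregate W t w) (W t.+1 q w)])) => q.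
  by apply: measurableC; apply: measurable_constraint; exact: mB.
apply/seteqP; split=> w [Br min]; split=> // q.
  by move=> [qr /min]; rewrite leqNgt qr.
by move=> Bq; rewrite leqNgt; apply/negP => qr; apply: (min q).
Qed.

Lemma measurable_sticks_of t S :
  (forall z, measurable [set w | aggregate W t w z]) ->
  measurable (sticks t S).
Proof.
move=> mA; rewrite (_ : sticks t S = [set w | exists p : (nat * (G * nat))%type,
   (S p.2 /\ ([set w | hits t w p.1] `&` [set w | W t.+1 p.1 w = p.2]) w)]).
  apply: (@measurable_exists_countable _ _ (nat * (G * nat))%type
    (fun p => [set w | S p.2 /\ ([set w | hits t w p.1] `&` [set w | W t.+1 p.1 w = p.2]) w])) => p.
  apply: measurable_constraint.
  by apply: measurableI; [exact: measurable_hits|exact: mW].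
apply/seteqP; split=> w /=.
  by move=> [r [hr Sr]]; exists (r, W t.+1 r w).
by move=> [[r y] /= [Sy [hr yE]]]; exists r; rewrite yE.
Qed.

Lemma measurable_aggregate t z : measurable [set w | aggregate W t w z].
Proof.
elim: t z => [|t IH] z /=.
  have [z0|z0] := pselect (layer 0 z).
    rewrite (_ : [set w | _] = setT); [exact: measurableT|].
    by apply/seteqP; split.
  rewrite (_ : [set w | _] = set0); [exact: measurable0|].
  by apply/seteqP; split=> // w /z0.
rewrite (_ : [set w | _] = [set w | aggregate W t w z] `|` sticks t [set z]).
  by apply: measurableU; [exact: IH|exact: measurable_sticks_of].
apply/seteqP; split=> w /= [Az|[r]]; [by left| |by left|].
  by move=> hr zE; right; exists r.
by move=> [hr zE]; right; exists r.
Qed.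

Lemma measurable_sticks t S : measurable (sticks t S).
Proof. by apply: measurable_sticks_of; exact: measurable_aggregate. Qed.

Lemma measurable_past a t : measurable (past a t).
Proof.
rewrite (_ : past a t = [set w | forall p : (nat * (G * nat))%type,
   (~` [set w | (p.1 <= t)%N /\ (~` (if p.2 \in a p.1 then [set w | aggregate W p.1 w p.2]
       else ~` [set w | aggregate W p.1 w p.2])) w]) w]).
  apply: (@measurable_forall_countable _ _ (nat * (G * nat))%type (fun p => ~` [set w | (p.1 <= t)%N /\ (~` (if p.2 \in a p.1 then [set w | aggregate W p.1 w p.2]
       else ~` [set w | aggregate W p.1 w p.2])) w])) => p.
  apply: measurableC; apply: measurable_constraint; apply: measurableC.
  by case: ifP => _; [|apply: measurableC]; exact: measurable_aggregate.
apply/seteqP; split=> w /=.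
  move=> pw [s y] /= [st]; apply.
  by case: ifPn => [/set_mem|/negP nay] /=; rewrite /setC /= pw// => /mem_set.
move=> H s st; apply/seteqP; split=> y.
  move=> Ay; apply: contrapT => nay; apply: (H (s, y)); split => //=.
  have /negbTE -> : y \notin a s by rewrite notin_setE.
  by move=> nAy; exact: nAy Ay.
move=> ay; apply: contrapT => nAy; apply: (H (s, y)); split => //=.
by rewrite mem_set.
Qed.

End Process.

(** * The law of the next particle *)

Section ProcessStep.
Variables (R : realType) (G : sgraph) (d : nat).
Variables (disp : measure_display) (Omega : measurableType disp).
Variables (P : probability Omega R) (W : nat -> nat -> Omega -> cyl G).
Hypothesis Greg : regular d G.
Hypothesis Gconn : connected_graph G.
Hypothesis dla : is_cylinder_dla P W.

Section Fixed.
Variables (a : nat -> set (cyl G)) (t M i : nat).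
Hypothesis AM : is_cluster (a t) M.

Let A := a t.
Let above : set (cyl G) := [set y | (i < y.2)%N].

Definition prefix (x : nat -> cyl G) r : set Omega :=
  [set w | forall q, (q <= r)%N -> W t.+1 q w = x q].

Lemma measurable_prefix x r : measurable (prefix x r).
Proof.
rewrite (_ : prefix x r = [set w | forall q, (~` [set w | (q <= r)%N /\
    (~` [set w | W t.+1 q w = x q]) w]) w]).
  apply: (@measurable_forall_countable _ _ nat (fun q => ~` [set w | (q <= r)%N /\
    (~` [set w | W t.+1 q w = x q]) w])) => q.
  apply: measurableC; apply: measurable_constraint; apply: measurableC.
  exact: dla.1.
apply/seteqP; split=> w /= H q; first by move=> [qr]; apply; exact: H.
by move=> qr; apply: contrapT => nW; apply: (H q).
Qed.

Let mpast : measurable (past W a t). Proof. exact: (measurable_past dla). Qed.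
Let msticks S : measurable (sticks W t S). Proof. exact: (measurable_sticks dla). Qed.

Lemma pr_prefix x r :
  pr P (past W a t `&` prefix x r) = pr P (past W a t) * walk_prob R A x r.
Proof.
apply/EFin_inj; rewrite EFinM -!prE//; last by apply: measurableI => //; exact: measurable_prefix.
exact: dla.2.
Qed.

Lemma walk_probS x y r : (forall q, (q <= r)%N -> y q = x q) ->
  walk_prob R A y r.+1 = walk_prob R A x r * cyl_step R (x r) (y r.+1).
Proof.
move=> yx; rewrite /walk_prob big_ord_recr/= (yx r)// mulrA yx//.
by congr (_ * _ * _); apply: eq_bigr => q _; rewrite !yx// ltnW.
Qed.

(** Induction on the number of remaining steps: the paths of the walk that stay
    outside the boundary extend the given one in disjoint ways. *)
Lemma pr_sticks_prefix N x r :
  (forall q, (q < r)%N -> ~ boundary A (x q)) -> ~ A (x r) ->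
  pr P (past W a t) * (walk_prob R A x r *
    green_upto d (fun y => y \notin hull A)
      (fun y => ((y \in hull A) && (i < y.2)%N)%:R) N (x r)) <=
  pr P (past W a t `&` prefix x r `&` sticks W t above).
Proof.
have mE y l : measurable (past W a t `&` prefix y l `&` sticks W t above).
  by do 2 apply: measurableI => //; exact: measurable_prefix.
elim: N x r => [|N IH] x r xB xrA; first by rewrite /= !mulr0 pr_ge0.
have AE w : past W a t w -> aggregate W t w = A by move=> pw; exact: pw.
rewrite /=; have [xrh|xrh] := boolP (x r \in hull A).
  rewrite addr0; case: ltnP => [xi|_]; last by rewrite !mulr0 pr_ge0.
  rewrite mulr1 -pr_prefix; apply: le_pr => //.
    by apply: measurableI => //; exact: measurable_prefix.
  move=> w [pw xw]; split=> //; exists r; rewrite /above /= xw//; split=> //.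
  rewrite /hits AE//; split=> /= [|q Bq].
    by rewrite xw//; case: (set_mem xrh).
  by rewrite leqNgt; apply/negP => qr; apply: (xB q qr); rewrite -xw// ltnW.
rewrite add0r; set f := green_upto _ _ _ _ in IH *.
have x0 : (0 < (x r).2)%N := notin_hull_gt0 AM xrh.
rewrite -(sum_cyl_step Greg f x0) pair_bigA /=.
pose ext (p : 'I_(x r).2.+2 * G) q := if (q <= r)%N then x q else (p.2, val p.1).
have extE p q : (q <= r)%N -> ext p q = x q by rewrite /ext => ->.
have extS p : ext p r.+1 = (p.2, val p.1) by rewrite /ext ltnn.
pose at_p (p : 'I_(x r).2.+2 * G) : cyl G := (p.2, val p.1).
have at_inj : injective at_p by move=> [k u] [l v] [/= -> /val_inj ->].
have := sum_pr_le P (dla.1 t r.+1) at_inj (index_enum_uniq _) (mE x r).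
apply: le_trans.
rewrite !mulr_sumr; apply: ler_sum => p _ /=.
rewrite -[((p.2, _) : cyl G)](extS p) [walk_prob R A x r * _]mulrA.
rewrite -(walk_probS (x := x) (y := ext p)); last exact: extE.
have [adjp|nadj] := boolP (cyl_adj (x r) (ext p r.+1)); last first.
  rewrite (_ : walk_prob _ _ _ _ = 0) ?mul0r ?mulr0 ?pr_ge0//.
  by rewrite (walk_probS (x := x))//; [rewrite /cyl_step (negPf nadj) mul0r mulr0|exact: extE].
apply: le_trans (IH (ext p) r.+1 _ _) _.
- move=> q; rewrite ltnS => qr; rewrite extE//; move: qr; rewrite leq_eqVlt.
  move=> /predU1P[->|/xB//] xb.
  by move: xrh; rewrite notin_setE; apply; right.
- by move=> Ay; move: xrh; rewrite notin_setE; apply; apply: adj_hull Ay _; rewrite cyl_adj_sym.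
- apply: le_pr => //.
    by apply: measurableI => //; exact: dla.1.
  move=> w [[pw yw] sw]; split; last by rewrite /= yw.
  by split=> //; split=> // q qr; rewrite -(extE p)// yw// leqW.
Qed.

(** The number of steps in [pr_sticks_prefix] tends to infinity, and the starting
    points are summed. *)
Lemma pr_sticks_ge :
  pr P (past W a t) * stick_mean R d A i <=
  pr P (past W a t `&` sticks W t above).
Proof.
set L := pr P (_ `&` _).
pose g (y : cyl G) : R := ((y \in hull A) && (i < y.2)%N)%:R.
pose D (y : cyl G) := y \notin hull A.
have n0 : 0 < #|G|%:R :> R by rewrite ltr0n; exact: Gconn.1.
have upto N : pr P (past W a t) * (#|G|%:R^-1 * \sum_v green_upto d D g N (v, M)) <= L.
  have at_inj : injective (fun v : G => ((v, M) : cyl G)) by move=> u v [].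
  have mL : measurable (past W a t `&` sticks W t above) by exact: measurableI.
  have := sum_pr_le P (dla.1 t 0%N) at_inj (index_enum_uniq _) mL.
  apply: le_trans.
  rewrite !mulr_sumr; apply: ler_sum => v _.
  have := @pr_sticks_prefix N (fun=> (v, M)) 0%N.
  rewrite /walk_prob big_ord0 mulr1 asboolT; last exact: is_cluster_first_empty.
  rewrite mul1r => /(_ _ _) H; apply: le_trans (H _ _) _ => //.
    by move=> /(cluster_lt AM); rewrite ltnn.
  apply: le_pr.
  - by apply: measurableI => //; apply: measurableI => //; exact: measurable_prefix.
  - by apply: measurableI => //; exact: dla.1.
  - by move=> w [[pw xw] sw]; split; [split|rewrite /= xw].
have cv : (fun N => pr P (past W a t) *
    (#|G|%:R^-1 * \sum_v green_upto d D g N (v, M))) @ \oo -->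
    pr P (past W a t) * stick_mean R d A i.
  apply: cvgMr; rewrite /stick_mean (heightE AM); apply: cvgMr.
  apply: cvg_big => [|v _]; first exact: add_continuous.
  apply: (@cvg_green_upto R G d D g (fun=> 1)) => //.
  by move=> x; exact: stick_supersolution.
have := cvgr_to_le cv; apply; by near=> N; exact: upto.
Unshelve. all: by end_near. Qed.

End Fixed.

End ProcessStep.

(** * Lyapunov functions of the process *)

Section IntegralCover.
Variables (R : realType) (disp : measure_display) (Omega : measurableType disp).
Variable P : probability Omega R.

(** As the pieces are equal or disjoint, removing from each piece the previous
    ones keeps it or empties it. *)
Lemma le_integral_cover (F : nat -> set Omega) (f g : Omega -> \bar R) :
  (forall k, measurable (F k)) -> \bigcup_k F k = setT ->
  (forall k l w, F k w -> F l w -> F k = F l) ->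
  measurable_fun setT f -> measurable_fun setT g ->
  (forall w, (0 <= f w)%E) -> (forall w, (0 <= g w)%E) ->
  (forall k, (\int[P]_(w in F k) f w <= \int[P]_(w in F k) g w)%E) ->
  (\int[P]_w f w <= \int[P]_w g w)%E.
Proof.
move=> mF coverF eqF mf mg f0 g0 fg.
have mD k : measurable (seqDU F k).
  by apply: measurableD => //; apply: bigsetU_measurable => i _.
rewrite -coverF seqDU_bigcup_eq.
rewrite !ge0_integral_bigcup//; try by apply: measurable_funTS.
apply: lee_nneseries => k _; first by move=> _; exact: integral_ge0.
have [[w [Fw nw]]|empty] := pselect (exists w, seqDU F k w); last first.
  rewrite (_ : seqDU F k = set0) ?integral_set0//.
  by apply/seteqP; split=> // w kw; apply: empty; exists w.
rewrite (_ : seqDU F k = F k)//.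
apply/seteqP; split=> [v [] //|v Fv]; split=> //.
rewrite -bigcup_mkord => -[l lk Flv]; apply: nw; rewrite -bigcup_mkord.
by exists l => //; rewrite -(eqF k l v).
Qed.

Lemma integral_affine (D L : set Omega) (c k : R) :
  measurable D -> measurable L -> 0 <= c -> 0 <= k ->
  (\int[P]_(w in D) (c + k * \1_L w)%:E = (c * pr P D + k * pr P (D `&` L))%:E)%E.
Proof.
move=> mD mL c0 k0; under eq_integral do rewrite EFinD EFinM.
rewrite ge0_integralD//; last 2 first.
- by move=> w _; rewrite lee_fin mulr_ge0.
- by apply/measurable_EFinP/measurable_funM => //; exact: measurable_indic.
rewrite integral_cst// ge0_integralZl_EFin//; last first.
  by apply/measurable_EFinP; exact: measurable_indic.
rewrite integral_indic// setIC EFinD !EFinM /pr !fineK ?fin_num_measure//.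
exact: measurableI.
Qed.

End IntegralCover.

Section LayerCount.
Variables (G : sgraph) (m : nat).

Definition low_count (A : set (cyl G)) : nat := (\sum_(1 <= j < m.+1) load A j)%N.

Lemma low_count_add A M y : is_cluster A M -> boundary A y ->
  (low_count (A `|` [set y]) <= low_count A + (y.2 <= m))%N.
Proof.
move=> AM yA; rewrite /low_count; under eq_bigr do rewrite load_add//.
rewrite big_split leq_add2l/=; case: (leqP y.2 m) => ym.
  rewrite (bigD1_seq y.2) ?iota_uniq//=; last first.
    by rewrite mem_index_iota ltnS ym andbT; have /andP[] := boundary_layer AM yA.
  by rewrite eqxx big1 ?addn0// => j; rewrite eq_sym => /negPf ->.
rewrite leqn0 big_nat big1// => j /andP[_]; rewrite ltnS => jm.
by case: eqP => // yj; move: ym; rewrite yj ltnNge jm.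
Qed.

Lemma low_count_le A : (low_count A <= m * #|G|)%N.
Proof.
apply: (@leq_trans (\sum_(1 <= j < m.+1) #|G|)%N).
  by apply: leq_sum => j _; exact: max_card.
by rewrite sum_nat_const_nat subSS subn0.
Qed.

End LayerCount.

Section Lyapunov.
Variables (R : realType) (G : sgraph) (d m : nat).
Variables (disp : measure_display) (Omega : measurableType disp).
Variables (P : probability Omega R) (W : nat -> nat -> Omega -> cyl G).
Hypothesis Greg : regular d G.
Hypothesis Gconn : connected_graph G.
Hypothesis dla : is_cylinder_dla P W.

Variables (Phi : set (cyl G) -> R) (C : R).
Hypothesis Phi_ge0 : forall A, 0 <= Phi A.
Hypothesis Phi_le : forall A, Phi A <= C.
(* The conditional expression bounds the probability that the next particle sticks
   in the layers up to [m]. *)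
Hypothesis Phi_drift : forall A M, is_cluster A M -> exists i w, [/\ 0 <= w,
  (if (m < M)%N then 1 - stick_mean R d A m else 1) <= w * stick_mean R d A i &
  forall y, boundary A y -> Phi A + w * (i < y.2)%:R <= Phi (A `|` [set y])].

(** A past is coded by the successive particles, with [None] for a particle that
    never sticks; so there are countably many pasts. *)
Definition code : Type := seq (option (G * nat)).

Definition decode (c : code) s : set (cyl G) :=
  layer 0 `|` [set y | Some y \in take s c].

Lemma exists_code w t : exists c : code, size c = t /\
  forall s, (s <= t)%N -> aggregate W s w = decode c s.
Proof.
elim: t => [|t [c [sc IH]]].
  exists [::]; split=> // s; rewrite leqn0 => /eqP ->.
  by rewrite /decode /=; apply/seteqP; split=> [y|y []//]; left.
have ext o s : (s <= t)%N -> decode (rcons c o) s = decode c s.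
  by move=> st; rewrite /decode -cats1 take_cat sc; case: ltngtP st => // ->; rewrite subnn take0 cats0 -sc take_size.
have ext1 o : decode (rcons c o) t.+1 = decode c t `|` [set y | Some y = o].
  rewrite /decode -sc -(size_rcons c o) !take_size -setUA; congr (_ `|` _).
  apply/seteqP; split=> y /=; rewrite mem_rcons in_cons.
    by move=> /orP[/eqP|]; [right|left].
  by move=> [->|->]; rewrite ?orbT// eqxx.
have [[AS _]|[r [_ _ AS]]] := aggregateS_cases W t w.
  exists (rcons c None); split; first by rewrite size_rcons sc.
  move=> s; rewrite leq_eqVlt ltnS => /predU1P[->|st]; last by rewrite ext// IH.
  by rewrite AS ext1 IH//; apply/seteqP; split=> y; [left|case].
exists (rcons c (Some (W t.+1 r w))); split; first by rewrite size_rcons sc.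
move=> s; rewrite leq_eqVlt ltnS => /predU1P[->|st]; last by rewrite ext// IH.
rewrite AS ext1 IH//; congr (_ `|` _); apply/seteqP; split=> y /=; first by move->.
by case.
Qed.

Definition past_of t k : set Omega :=
  if unpickle k is Some c then past W (decode c) t else set0.

Lemma measurable_past_of t k : measurable (past_of t k).
Proof.
by rewrite /past_of; case: unpickle => [c|]; [exact: (measurable_past dla)|exact: measurable0].
Qed.

Lemma bigcup_past_of t : \bigcup_k past_of t k = setT.
Proof.
apply/seteqP; split=> // w _; have [c [_ cE]] := exists_code w t.
by exists (pickle c) => //; rewrite /past_of pickleK.
Qed.

Lemma past_of_eq t k l w : past_of t k w -> past_of t l w ->
  past_of t k = past_of t l.
Proof.
rewrite /past_of; case: unpickle => // c; case: unpickle => // c' pc pc'.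
by apply/seteqP; split=> v pv s st; rewrite pv// -pc// -pc'.
Qed.

Lemma measurable_fun_aggregate t (f : set (cyl G) -> R) :
  measurable_fun setT (fun w => f (aggregate W t w)).
Proof.
move=> _ B mB; rewrite setTI.
rewrite (_ : _ @^-1` B = [set w | exists k,
    (past_of t k `&` [set w | B (f (aggregate W t w))]) w]); last first.
  apply/seteqP; split=> w /=; last by case=> k [].
  have : (\bigcup_k past_of t k) w by rewrite bigcup_past_of.
  by case=> k _ kw Bw; exists k.
apply: (@measurable_exists_countable _ _ nat (fun k => past_of t k `&` [set w | B (f (aggregate W t w))])) => k.
have [[w [kw Bw]]|empty] := pselect (exists w, past_of t k w /\ B (f (aggregate W t w))).
  rewrite (_ : _ `&` _ = past_of t k); first exact: measurable_past_of.
  apply/seteqP; split=> [v []//|v kv]; split=> //=.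
  move: kw kv; rewrite /past_of; case: unpickle => // c pw pv.
  by rewrite pv// -pw.
rewrite (_ : _ `&` _ = set0); first exact: measurable0.
by apply/seteqP; split=> // v [kv Bv]; apply: empty; exists v.
Qed.

Let N (A : set (cyl G)) : R := (low_count m A)%:R.

Let mean (f : set (cyl G) -> R) t : \bar R :=
  (\int[P]_w (f (aggregate W t w))%:E)%E.

(** Given the past, the increments of the count and of the Lyapunov function are
    compared through the probabilities of sticking low and of sticking high. *)
Lemma step_past a t :
  (\int[P]_(w in past W a t) (N (aggregate W t.+1 w) + Phi (aggregate W t w))%:E <=
   \int[P]_(w in past W a t) (N (aggregate W t w) + Phi (aggregate W t.+1 w))%:E)%E.
Proof.
have mp : measurable (past W a t) by exact: (measurable_past dla).
have [[w0 pw0]|empty] := pselect (exists w, past W a t w); last first.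
  rewrite (_ : past W a t = set0) ?integral_set0//.
  by apply/seteqP; split=> // w pw; apply: empty; exists w.
have [M] := is_cluster_aggregate W Gconn t w0; rewrite pw0//.
set A := a t => AM.
have AE w : past W a t w -> aggregate W t w = A by move=> pw; exact: pw.
have [i [k [k0 kdrift Phik]]] := Phi_drift AM.
pose low : set (cyl G) := [set y | (y.2 <= m)%N].
pose above j : set (cyl G) := [set y | (j < y.2)%N].
have ms S : measurable (sticks W t S) by exact: (measurable_sticks dla).
have NPhi0 : 0 <= N A + Phi A by rewrite addr_ge0.
have mf s l : measurable_fun (past W a t)
    (fun w => (N (aggregate W s w) + Phi (aggregate W l w))%:E).
  apply/measurable_EFinP/measurable_funTS/measurable_funD;
  exact: measurable_fun_aggregate.
have mg c1 c2 L : measurable L -> measurable_fun (past W a t)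
    (fun w => (c1 + c2 * \1_L w)%:E : \bar R).
  move=> mL; apply/measurable_EFinP/measurable_funD => //.
  by apply/measurable_funM => //; exact: measurable_indic.
apply: (@le_trans _ _ (\int[P]_(w in past W a t)
    (N A + Phi A + 1 * \1_(sticks W t low) w)%:E)%E).
  apply: ge0_le_integral => //.
  - by move=> w _; rewrite lee_fin addr_ge0.
  - exact: mg.
  - move=> w pw; rewrite lee_fin (AE w pw) addrAC lerD2r mul1r.
    have [[-> _]|[r [hr yA ->]]] := aggregateS_cases W t w.
      by rewrite AE// lerDl.
    rewrite AE// in yA *; set y := W t.+1 r w in yA *.
    apply: (@le_trans _ _ (N A + (y.2 <= m)%N%:R)).
      by rewrite -natrD ler_nat; exact: low_count_add AM yA.
    rewrite lerD2l indicE; case: leqP => // ym.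
    by rewrite mem_set//; exists r.
apply: (@le_trans _ _ (\int[P]_(w in past W a t)
    (N A + Phi A + k * \1_(sticks W t (above i)) w)%:E)%E); last first.
  apply: ge0_le_integral => //.
  - by move=> w _; rewrite lee_fin addr_ge0// mulr_ge0.
  - exact: mg.
  - move=> w pw; rewrite lee_fin (AE w pw) -addrA lerD2l.
    have [[-> nh]|[r [hr yA ->]]] := aggregateS_cases W t w.
      rewrite AE// indicE memNset ?mulr0 ?addr0//.
      by move=> [r [hr _]]; exact: nh hr.
    rewrite AE// in yA *; set y := W t.+1 r w in yA *.
    apply: le_trans (Phik y yA); rewrite lerD2l ler_wpM2l// indicE ler_nat.
    case: (boolP (w \in _)) => // /set_mem[q [hq]]; rewrite /above /=.
    by rewrite (is_min_uniq hq hr) => ->.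
rewrite !integral_affine// lee_fin lerD2l mul1r.
have := pr_sticks_ge Greg Gconn dla i AM => Hi.
apply: le_trans (ler_wpM2l k0 Hi).
rewrite mulrCA; have p0 : 0 <= pr P (past W a t) := pr_ge0 _ _.
apply: le_trans (ler_wpM2l p0 kdrift).
case: ifP => mM; last first.
  by rewrite mulr1; apply: le_pr; [exact: measurableI|by []|move=> w []].
have Hm := pr_sticks_ge Greg Gconn dla m AM.
rewrite mulrBr mulr1 lerBrDr; apply: le_trans (lerD (lexx _) Hm) _.
rewrite [leRHS](prID P mp (ms (above m))) addrC lerD2l.
apply: le_pr; [exact: measurableI| |].
  by apply: measurableI => //; exact: measurableC.
move=> w [pw [r [hr yl]]]; split=> // -[q [hq]].
by rewrite /above /= (is_min_uniq hq hr) ltnNge yl.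
Qed.

Lemma measurable_EFin_aggregate (T : set (cyl G) -> R) t :
  measurable_fun setT (fun w => (T (aggregate W t w))%:E).
Proof. by apply/measurable_EFinP; exact: measurable_fun_aggregate. Qed.

Let meanE (f : set (cyl G) -> R) K t : (forall A, 0 <= f A) ->
  (forall A, f A <= K) -> mean f t = (fine (mean f t))%:E /\
  0 <= fine (mean f t) <= K.
Proof.
move=> f0 fK.
have m0 : (0 <= mean f t)%E by apply: integral_ge0 => w _; rewrite lee_fin.
have mK : (mean f t <= K%:E)%E.
  rewrite -[leRHS]mule1 -[1%E](@probability_setT _ _ _ P) -integral_cst//.
  apply: ge0_le_integral => //.
  - by move=> w _; rewrite lee_fin.
  - exact: measurable_EFin_aggregate.
  - by move=> w _; rewrite lee_fin.
have E : mean f t = (fine (mean f t))%:E.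
  by rewrite fineK// ge0_fin_numE//; apply: le_lt_trans mK _; exact: ltry.
by split=> //; rewrite -!lee_fin -E m0.
Qed.

(** The bounds of [step_past] are summed over the pasts and telescope over time;
    the count vanishes at time 0. *)
Lemma mean_low_count_le t :
  (\int[P]_w ((low_count m (aggregate W t w))%:R%:E) <= C%:E)%E.
Proof.
have N0 A : 0 <= N A by [].
have NK A : N A <= (m * #|G|)%:R by rewrite ler_nat low_count_le.
have nE s := (meanE s N0 NK).1.
have pE s := meanE s Phi_ge0 Phi_le.
have step s : fine (mean N s.+1) + fine (mean Phi s) <=
    fine (mean N s) + fine (mean Phi s.+1).
  have splitE (f g : set (cyl G) -> R) k l : (forall A, 0 <= f A) -> (forall A, 0 <= g A) ->
      (\int[P]_w (f (aggregate W k w) + g (aggregate W l w))%:E = mean f k + mean g l)%E.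
    move=> f0 g0; under eq_integral do rewrite EFinD.
    rewrite ge0_integralD//; [|exact: measurable_EFin_aggregate| |exact: measurable_EFin_aggregate];
    by move=> w _; rewrite lee_fin.
  have := @le_integral_cover R disp Omega P (past_of s)
    (fun w => (N (aggregate W s.+1 w) + Phi (aggregate W s w))%:E)
    (fun w => (N (aggregate W s w) + Phi (aggregate W s.+1 w))%:E)
    (@measurable_past_of s) (bigcup_past_of s) (@past_of_eq s).
  rewrite !splitE// (nE s) (nE s.+1) (pE s).1 (pE s.+1).1 -!EFinD lee_fin; apply.
  - by apply/measurable_EFinP/measurable_funD; exact: measurable_fun_aggregate.
  - by apply/measurable_EFinP/measurable_funD; exact: measurable_fun_aggregate.
  - by move=> w; rewrite lee_fin addr_ge0.
  - by move=> w; rewrite lee_fin addr_ge0.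
  - move=> k; rewrite /past_of; case: unpickle => [c|]; first exact: step_past.
    by rewrite !integral_set0.
have tele : fine (mean N t) + fine (mean Phi 0) <= fine (mean N 0) + fine (mean Phi t).
  by elim: t => [//|s IH]; have := step s; lra.
have N00 : fine (mean N 0) = 0.
  rewrite /mean integral0_eq// => w _; congr (_%:E).
  rewrite /N /low_count big_nat big1// => j /andP[j0 _].
  apply/eqP; rewrite -leqn0 leqNgt; apply/negP => /load_gt0P[v /= vj].
  by move: j0; rewrite (vj : j = 0%N).
rewrite -/(mean N t) (nE t) lee_fin.
by have /andP[_] := (pE t).2; have /andP[] := (pE 0%N).2; lra.
Qed.

(** Only finitely many vertices matter, so the counts are eventually constant. *)
Lemma low_count_eventually w : exists T, forall t, (T <= t)%N ->
  low_count m (aggregate W t w) = low_count m (final_aggregate W w).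
Proof.
have sub s t : (s <= t)%N -> aggregate W s w `<=` aggregate W t w.
  elim: t => [|t IH]; first by rewrite leqn0 => /eqP ->.
  rewrite leq_eqVlt => /predU1P[->//|/IH st] y /st Ay.
  by left.
have /choice[T TP] : forall p : 'I_m.+1 * G, exists T, forall t, (T <= t)%N ->
    ((p.2, val p.1) \in aggregate W t w) = ((p.2, val p.1) \in final_aggregate W w).
  move=> p; have [[T _ Tp]|np] := pselect (final_aggregate W w (p.2, val p.1)).
    exists T => t Tt; rewrite !mem_set//; last exact: sub Tt _ Tp.
    by exists T.
  exists 0%N => t _; rewrite !memNset// => Ap.
  by apply: np; exists t.
exists (\max_p T p) => t Tt; rewrite /low_count !big_nat; apply: eq_bigr => j /andP[_ jm].
apply: eq_card => v; rewrite !inE.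
have := TP (Ordinal jm, v) t; apply.
exact: leq_trans (leq_bigmax _) Tt.
Qed.

Lemma measurable_low_count_final :
  measurable_fun setT (fun w => (low_count m (final_aggregate W w))%:R : R).
Proof.
apply: (@measurable_fun_cvg _ _ _ _ (fun t w => N (aggregate W t w))).
  by move=> t; exact: measurable_fun_aggregate.
move=> w _; have [T TP] := low_count_eventually w.
apply: cvg_near_cst; near=> t; rewrite /N TP//.
by near: t; exists T.
Unshelve. all: by end_near. Qed.

Lemma mean_low_count_final_le :
  (\int[P]_w ((low_count m (final_aggregate W w))%:R%:E) <= C%:E)%E.
Proof.
have := @dominated_convergence _ _ R P setT measurableT
  (fun t w => (N (aggregate W t w))%:E)
  (fun w => (low_count m (final_aggregate W w))%:R%:E)
  (cst (m * #|G|)%:R%:E).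
case.
- by move=> t; exact: measurable_EFin_aggregate.
- by apply/measurable_EFinP; exact: measurable_low_count_final.
- apply: aeW => w _; have [T TP] := low_count_eventually w.
  apply: cvg_near_cst; near=> t; rewrite /N TP//.
  by near: t; exists T.
- exact: finite_measure_integrable_cst.
- by apply: aeW => w t _; rewrite abse_EFin lee_fin ger0_norm// ler_nat low_count_le.
move=> _ _ cv; apply: (cvge_to_le cv); near=> t.
exact: mean_low_count_le.
Unshelve. all: by end_near. Qed.

End Lyapunov.

(** * The density at infinity *)

Section Density.
Variables (R : realType) (G : sgraph).
Variables (disp : measure_display) (Omega : measurableType disp).
Variables (P : probability Omega R) (W : nat -> nat -> Omega -> cyl G).
Hypothesis Gconn : connected_graph G.
Hypothesis dla : is_cylinder_dla P W.

(** The densities up to [m] are bounded, so their means converge to the density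
    at infinity. *)
Lemma density_le (D q : R) (C : nat -> R) :
  is_density_at_infinity P W D ->
  (forall m, (\int[P]_w ((low_count m (final_aggregate W w))%:R%:E) <= (C m)%:E)%E) ->
  (m%:R * #|G|%:R)^-1 * C m @[m --> \oo] --> q ->
  0 <= D <= q.
Proof.
move=> DP CP Cq.
pose f m w : R := density_upto R W w m.
have fE m w : f m w = (m%:R * #|G|%:R)^-1 * (low_count m (final_aggregate W w))%:R.
  by rewrite /f /density_upto /low_count natr_sum.
have n0 : 0 < #|G|%:R :> R by rewrite ltr0n; exact: Gconn.1.
have f0 m w : 0 <= f m w by rewrite fE mulr_ge0// invr_ge0 mulr_ge0.
have f1 m w : f m w <= 1.
  rewrite fE; case: m => [|m]; first by rewrite mul0r invr0 mul0r.
  have m0 : 0 < m.+1%:R * #|G|%:R :> R by rewrite mulr_gt0.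
  by rewrite ler_pdivrMl// mulr1 -natrM ler_nat low_count_le.
have mf m : measurable_fun setT (fun w => f m w).
  rewrite (_ : (fun w => _) = (fun w => (m%:R * #|G|%:R)^-1 *
     (low_count m (final_aggregate W w))%:R)); last by apply/funext => w; rewrite fE.
  by apply: measurable_funM => //; exact: measurable_low_count_final dla.
have [] := @dominated_convergence _ _ R P setT measurableT
  (fun m w => (f m w)%:E) (cst D%:E) (cst 1%E).
- by move=> m; apply/measurable_EFinP.
- exact: measurable_cst.
- apply: filterS DP => w cv _.
  by apply: cvg_EFin; [near=> m|exact: cv].
- exact: finite_measure_integrable_cst.
- by apply: aeW => w m _; rewrite abse_EFin lee_fin ger0_norm.
have PD : (\int[P]_w cst D%:E w = D%:E)%E.
  rewrite integral_cst// -[RHS]mule1; congr (_ * _)%E.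
  exact: probability_setT.
move=> _ _; rewrite PD => cv.
apply/andP; split; rewrite -lee_fin.
  apply: (cvge_to_ge cv); near=> m.
  by apply: integral_ge0 => w _; rewrite lee_fin.
have Cq' : ((m%:R * #|G|%:R)^-1 * C m)%:E @[m --> \oo] --> q%:E by apply: cvg_EFin => //; near=> m.
apply: (lee_cvg_to cv Cq'); near=> m => /=.
under eq_integral do rewrite fE EFinM.
rewrite ge0_integralZl_EFin//.
- by rewrite EFinM; apply: lee_wpmul2l; [rewrite lee_fin invr_ge0 mulr_ge0|exact: CP].
- by apply/measurable_EFinP; exact: measurable_low_count_final dla.
Unshelve. all: by end_near. Qed.

End Density.

(** The two potentials together form a Lyapunov function: one of them drives the
    drift, according to the position of the top of the cluster, while the other
    does not decrease. *)
Lemma density_le_omega (R : realType) (G : sgraph) (d omega h kappa tau : nat)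
    (disp : measure_display) (Omega : measurableType disp)
    (P : probability Omega R) (W : nat -> nat -> Omega -> cyl G) (D : R) :
  regular d G -> connected_graph G -> (2 <= d)%N ->
  (forall u v : G, (2 * #|G|%:R)^-1 <= lazy_prob R tau v u) ->
  (0 < kappa)%N -> (tau <= kappa ^ 2)%N -> (64 * omega * kappa <= h)%N ->
  (0 < omega)%N ->
  (4 * (d + 2) * (d + 3) * ratio omega h ^ h * h ^ 2 <= #|G|)%N ->
  is_cylinder_dla P W -> is_density_at_infinity P W D ->
  0 <= D <= 2 / omega%:R.
Proof.
move=> Greg Gconn d2 mixed k0 tk hk o0 small dla Dinf.
pose n : R := #|G|%:R; pose c : R := trap_rate R G d.
have n0 : 0 < n by rewrite ltr0n; exact: Gconn.1.
pose C (m : nat) : R := n * (2 * m.+1%:R / omega%:R) + n / c.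
apply: (density_le Gconn dla (C := C) Dinf).
  move=> m.
  pose Phi (A : set (cyl G)) := low_potential R omega h m A + high_potential R d m A.
  apply: (@mean_low_count_final_le R G d m _ _ P W Greg Gconn dla Phi (C m)).
  - by move=> A; rewrite addr_ge0 ?low_potential_ge0 ?high_potential_ge0.
  - move=> A; rewrite lerD//; first exact: low_potential_le k0 hk o0 A.
    exact: high_potential_le Gconn A.
  - move=> A M AM; case: ltnP => mM.
      have [i [w [w0 uw hw]]] := high_drift R Greg Gconn AM mM.
      exists i, w; split=> // y yA; rewrite -addrA lerD ?hw//.
      exact: low_potential_nd Gconn A y yA.
    have [i [w [w0 uw lw]]] := low_drift Greg Gconn d2 mixed k0 tk hk o0 small AM mM.
    exists i, w; split=> // y yA; rewrite addrAC lerD ?lw//.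
    exact: high_potential_nd Gconn A M AM y yA.
have c0 : 0 < c by rewrite invr_gt0 exprn_gt0// ltr0n addn2.
rewrite -cvg_shiftS /=.
rewrite (_ : (fun m : nat => _) =
    (fun m => 2 / omega%:R + (2 / omega%:R + c^-1) * harmonic m)); last first.
  apply/funext => m; rewrite /C /harmonic /= -(@natr1 R m.+1) -/n; field.
  by rewrite !gt_eqF// ?ltr0n.
suff : 2 / omega%:R + (2 / omega%:R + c^-1) * harmonic m @[m --> \oo] -->
    2 / omega%:R + (2 / omega%:R + c^-1) * 0 by rewrite mulr0 addr0.
apply: cvgD; first exact: cvg_cst.
by apply: cvgMr; exact: cvg_harmonic.
Qed.

Lemma exists_sqrt_nat tau : (0 < tau)%N ->
  exists kappa, (0 < kappa)%N /\ (tau <= kappa ^ 2 <= 4 * tau)%N.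
Proof.
move=> t0; have ex : exists k, (tau <= k ^ 2)%N by exists tau; nia.
have [k tk mink] := ex_minnP ex; exists k.
have k0 : (0 < k)%N by case: k tk {mink}; lia.
split=> //; rewrite tk /=; have [k1|k1] := leqP k 1; first nia.
have : (k.-1 ^ 2 < tau)%N.
  by rewrite ltnNge; apply/negP => /mink; lia.
nia.
Qed.

(** * Choice of the scales *)

Section ScaleChoice.
Variables (R : realType) (d omega : nat).
Hypothesis omega0 : (0 < omega)%N.

(** With [L = ln n] and [l = ln L], the window [h] is of order [L / l ^ 2]. This is
    much more than the square root of the mixing time, which is at most
    [L / l ^ (5 / 2)]; and [h * ln h], of order [L / l], is much less than
    [ln n], so that [ratio ^ h] is small compared with [n]. *)
Lemma exists_parameters : exists n0, forall n tau : nat, (n0 <= n)%N -> (0 < tau)%N ->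
  tau%:R <= (ln n%:R : R) ^+ 2 / ln (ln n%:R) ^+ 5 ->
  exists kappa h, [/\ (0 < kappa)%N, (tau <= kappa ^ 2)%N,
    (64 * omega * kappa <= h)%N &
    (4 * (d + 2) * (d + 3) * ratio omega h ^ h * h ^ 2 <= n)%N].
Proof.
pose K := (4 * (d + 2) * (d + 3))%N.
pose l0 : R := 64 ^+ 2 * (4 * omega%:R ^+ 2) + K%:R + 20.
exists (Num.bound (expR (expR l0))) => n tau nn t0 tl.
have nR : expR (expR l0) <= n%:R.
  apply: le_trans (_ : (Num.bound (expR (expR l0)))%:R <= _); last by rewrite ler_nat.
  by apply: ltW; apply: archi_boundP; exact: expR_ge0.
have n0 : 0 < n%:R :> R by apply: lt_le_trans nR; exact: expR_gt0.
set L := ln n%:R in tl; have nE : n%:R = expR L by rewrite lnK.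
have LR : expR l0 <= L by rewrite -(@ler_expR R) -nE.
have L0 : 0 < L by apply: lt_le_trans LR; exact: expR_gt0.
set l := ln L in tl; have LE : L = expR l by rewrite lnK.
have lR : l0 <= l by rewrite -(@ler_expR R) -LE.
have l0E : l0 = 64 ^+ 2 * (4 * omega%:R ^+ 2) + K%:R + 20 by [].
have K0 : 0 <= K%:R :> R by [].
have o1 : 1 <= omega%:R :> R by rewrite ler1n.
have o2 : 1 <= omega%:R ^+ 2 :> R by rewrite expr_ge1//; lra.
have lL : 1 + l <= L by rewrite LE expR_ge1Dx.
have [kappa [k0 /andP[tk k4]]] := exists_sqrt_nat t0.
have l20 : 20 <= l by lra.
have lpos : 0 < l by lra.
pose x := L / l ^+ 2.
have x0 : 0 <= x by rewrite divr_ge0 ?exprn_ge0//; lra.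
exists kappa, (Num.truncn x).
have hx : (Num.truncn x)%:R <= x by rewrite truncn_le.
have hk : (64 * omega * kappa <= Num.truncn x)%N.
  rewrite truncn_ge_nat// -(@ler_pXn2r _ 2)// ?nnegrE//.
  rewrite [leLHS](_ : _ = 64 ^+ 2 * omega%:R ^+ 2 * (kappa ^ 2)%:R); last first.
    by rewrite natrX !natrM; ring.
  have k4r : (kappa ^ 2)%:R <= 4 * tau%:R :> R by rewrite -natrM ler_nat.
  apply: (@le_trans _ _ (64 ^+ 2 * omega%:R ^+ 2 * (4 * (L ^+ 2 / l ^+ 5)))).
    rewrite ler_wpM2l ?mulr_ge0 ?sqr_ge0//.
    by apply: le_trans k4r _; rewrite ler_wpM2l.
  rewrite [leRHS](_ : _ = l * (L ^+ 2 / l ^+ 5)); last by rewrite /x; field; rewrite gt_eqF.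
  rewrite mulrA ler_wpM2r//; first by rewrite divr_ge0 ?exprn_ge0//; lra.
  lra.
split=> //.
set h := Num.truncn x in hx hk *.
have h0 : (0 < h)%N by apply: leq_trans hk; rewrite !muln_gt0 omega0.
have xL : x <= L.
  rewrite /x ler_pdivrMr ?exprn_gt0//; rewrite ler_peMr//; first lra.
  by rewrite expr_ge1//; lra.
have hL : h%:R <= L by exact: le_trans hx xL.
have KL : K%:R <= L by lra.
have oL : omega%:R <= L by nra.
rewrite -(ler_nat R) !natrM natrX /ratio natrM nE.
apply: (@le_trans _ _ (L * (L * L) ^+ h * (L * L))).
  rewrite ler_pM ?mulr_ge0 ?exprn_ge0 ?mulr_ge0//.
    rewrite ler_pM ?exprn_ge0 ?mulr_ge0//.
      by move: KL; rewrite /K !natrM.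
    by rewrite lerXn2r ?nnegrE ?mulr_ge0 ?ler_pM// ltW.
  by rewrite ler_pM.
rewrite [leLHS](_ : _ = L ^+ (2 * h + 3)); last first.
  by rewrite exprD exprM expr2; set z := (L * L) ^+ h; ring.
rewrite LE -expRM_natl ler_expR -LE.
have hl : h%:R * l ^+ 2 <= L by rewrite -ler_pdivlMr ?exprn_gt0.
have Lq : 1 + l + l ^+ 2 / 4 <= L.
  rewrite LE (_ : l = l / 2 + l / 2); last by field.
  have e1 := expR_ge1Dx (l / 2).
  rewrite expRD; apply: le_trans (ler_pM _ _ e1 e1); lra.
rewrite natrD natrM.
have : 20 * (h%:R * l) <= h%:R * l ^+ 2.
  by rewrite expr2 [leRHS]mulrA [leRHS]mulrC ler_wpM2r// mulr_ge0// ltW.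
nra.
Qed.

End ScaleChoice.

Theorem theorem4p8 (R : realType) (d : nat) (hd : (2 <= d)%N)
  (G : nat -> sgraph)
  (hconn : forall n, connected_graph (G n))
  (hreg : forall n, regular d (G n))
  (hcard : #|G n| @[n --> \oo] --> \oo)
  (mix : nat -> nat) (hmix : forall n, is_mixing_time R (G n) (mix n))
  (hmix_le : forall n, (mix n)%:R <=
     (ln (#|G n|%:R : R)) ^+ 2 / (ln (ln (#|G n|%:R : R))) ^+ 5)
  (disp : nat -> measure_display)
  (Omega : forall n, measurableType (disp n))
  (P : forall n, probability (Omega n) R)
  (W : forall n, nat -> nat -> Omega n -> cyl (G n))
  (hdla : forall n, is_cylinder_dla (P n) (W n))
  (D : nat -> R) (hD : forall n, is_density_at_infinity (P n) (W n) (D n)) :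
  D n @[n --> \oo] --> (0 : R).
Proof.
apply/cvgrPdist_le => e e0.
pose omega := (Num.bound (2 / e)).+1.
have oe : 2 / omega%:R <= e.
  rewrite ler_pdivrMr ?ltr0n// mulrC -ler_pdivrMr//.
  have : 0 <= 2 / e by rewrite divr_ge0// ltW.
  by move/archi_boundP/ltW/le_trans; apply; rewrite ler_nat.
have [n0 n0P] := exists_parameters R d (isT : (0 < omega)%N).
have large : \forall n \near \oo, (n0 <= #|G n|)%N.
  by move/cvgnyPge : hcard; apply.
near=> n.
have [[mix0 mixed] _] := hmix n.
have n0n : (n0 <= #|G n|)%N by near: n.
have [kappa [h [k0 tk hk small]]] := n0P #|G n| (mix n) n0n mix0 (hmix_le n).
have /andP[D0 D1] := density_le_omega (hreg n) (hconn n) hd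
  (fun u v => mixed u v (mix n) (leqnn _)) k0 tk hk isT small (hdla n) (hD n).
by rewrite sub0r normrN ger0_norm// (le_trans D1).
Unshelve. all: by end_near. Qed.
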